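(* For all $\tau\in\mathbb{H}$, with $E=\left(\frac{\eta(\tau)}{\eta(7\tau)}\right)^4$, $$\frac{v^4u^2}{w^6}+\frac{u^4w^2}{v^6}+\frac{w^4v^2}{u^6}=E^2+14E+54,$$ $$\frac{w^6}{v^4u^2}+\frac{v^6}{u^4w^2}+\frac{u^6}{w^4v^2}=E^2+12E+41.$$
   Context: Let $\tau\in\mathbb{H}$, $q=e^{2\pi i\tau}$, $q^{\alpha}=e^{2\pi i\alpha\tau}$. Define $u=q^{1/56}\prod_{k\ge0}(1-q^{7k+3})(1-q^{7k+4})(1-q^{7k+7})$, $v=q^{9/56}\prod_{k\ge0}(1-q^{7k+2})(1-q^{7k+5})(1-q^{7k+7})$, $w=q^{25/56}\prod_{k\ge0}(1-q^{7k+1})(1-q^{7k+6})(1-q^{7k+7})$, and $\eta(\tau)=q^{1/24}\prod_{n\ge1}(1-q^n)$. *)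

(* Defs.v *)
From Stdlib Require Import Reals.
From Coquelicot Require Import Coquelicot.
Open Scope C_scope.

Definition cexp (z : C) : C :=
  (exp (Re z) * cos (Im z), exp (Re z) * sin (Im z))%R.

Definition qpow (alpha : R) (tau : C) : C :=
  cexp (RtoC (2 * PI * alpha) * (Ci * tau)).

Fixpoint cpow (z : C) (n : nat) : C :=
  match n with O => 1 | S m => cpow z m * z end.

Fixpoint cprod_upto (f : nat -> C) (N : nat) : C :=
  match N with O => 1 | S M => cprod_upto f M * f M end.

Definition cinfprod (f : nat -> C) : C :=
  @lim (CompleteNormedModule.CompleteSpace _ C_CompleteNormedModule)
       (filtermap (cprod_upto f) eventually).

Definition u (tau : C) : C :=
  qpow (1/56) tau * cinfprod (fun k =>
    (1 - qpow (7 * INR k + 3) tau) * (1 - qpow (7 * INR k + 4) tau)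
      * (1 - qpow (7 * INR k + 7) tau)).

Definition v (tau : C) : C :=
  qpow (9/56) tau * cinfprod (fun k =>
    (1 - qpow (7 * INR k + 2) tau) * (1 - qpow (7 * INR k + 5) tau)
      * (1 - qpow (7 * INR k + 7) tau)).

Definition w (tau : C) : C :=
  qpow (25/56) tau * cinfprod (fun k =>
    (1 - qpow (7 * INR k + 1) tau) * (1 - qpow (7 * INR k + 6) tau)
      * (1 - qpow (7 * INR k + 7) tau)).

Definition eta (tau : C) : C :=
  qpow (1/24) tau * cinfprod (fun k => 1 - qpow (INR k + 1) tau).

(* Main.v *)
(* Put q = e^{2 pi i tau} and p = q^7. Up to powers of q and a common factor,
   u, v, w are the theta values th(q^3), th(q^2), th(q) for the base p, and
   eta(tau)/eta(7 tau) is q^{-1/4} th(q) th(q^2) th(q^3).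
   By the Jacobi triple product th is a series over the integers; multiplying two
   such series and splitting the double sum by parity gives
   th(xy) th(x/y) / x = A(x) B(y) - B(x) A(y), hence a function P of Weierstrass
   type whose differences P(x) - P(y) are theta quotients.  The additive relation
   among P(q), P(q^2), P(q^3) is the Klein quartic v^3 u = u^3 w + w^3 v.
   The values e_1, e_2, e_3 of P at -1, p^{1/2}, -p^{1/2} are the roots of a monic
   cubic whose values at P(q), P(q^2), P(q^3) are monomials in the thetas, by the
   duplication formula; so the cubic is found by interpolation.  On the other hand
   its discriminant is p/16, because th(-1) th(p^{1/2}) th(-p^{1/2}) = 2.
   Comparing, t + 1 - 1/t - 1/(t-1) = E + 8 with t = v^2 u / w^3, and both
   identities are rational consequences, since u^2 w / v^3 = (t-1)/t and
   w^2 v / u^3 = 1/(t-1). *)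

Require Import Defs.
From Stdlib Require Import Reals Lra Lia ZArith.
From Coquelicot Require Import Coquelicot.
Open Scope C_scope.

(** * Limits of complex sequences *)

(** Stated through the real sequence of moduli, so that the real limit lemmas apply directly; the
    filter form is needed only where [lim] itself occurs. *)
Definition Cconv (s : nat -> C) (l : C) : Prop :=
  is_lim_seq (fun n => Cmod (s n - l)) 0%R.

Lemma Cconv_filterlim (s : nat -> C) (l : C) :
  Cconv s l <-> filterlim s eventually (@locally C_NormedModule l).
Proof.
unfold Cconv; rewrite <- is_lim_seq_spec; unfold is_lim_seq'.
split; intros H.
- apply (proj2 (filterlim_locally_ball_norm (U := C_NormedModule) s l)).
  intros eps; destruct (H eps) as [N HN]; exists N; intros n Hn.
  specialize (HN n Hn).
  rewrite Rminus_0_r, Rabs_pos_eq in HN by apply Cmod_ge_0.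
  exact HN.
- intros eps.
  destruct (proj1 (filterlim_locally_ball_norm (U := C_NormedModule) s l) H eps)
    as [N HN]; exists N; intros n Hn.
  rewrite Rminus_0_r, Rabs_pos_eq by apply Cmod_ge_0.
  exact (HN n Hn).
Qed.

Lemma Cconv_eps (s : nat -> C) (l : C) :
  Cconv s l <->
  forall eps : R, (0 < eps)%R ->
    exists N, forall n, (N <= n)%nat -> (Cmod (s n - l) < eps)%R.
Proof.
unfold Cconv; rewrite <- is_lim_seq_spec; unfold is_lim_seq'.
split; intros H.
- intros eps He; destruct (H (mkposreal eps He)) as [N HN]; exists N; intros n Hn.
  specialize (HN n Hn).
  rewrite Rminus_0_r, Rabs_pos_eq in HN by apply Cmod_ge_0.
  exact HN.
- intros [eps He]; destruct (H eps He) as [N HN]; exists N; intros n Hn.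
  rewrite Rminus_0_r, Rabs_pos_eq by apply Cmod_ge_0.
  exact (HN n Hn).
Qed.

Lemma Cconv_squeeze (s : nat -> C) (l : C) (r : nat -> R) :
  (forall n, (Cmod (s n - l) <= r n)%R) -> is_lim_seq r 0%R -> Cconv s l.
Proof.
intros H Hr; unfold Cconv.
apply is_lim_seq_le_le with (u := fun _ => 0%R) (w := r); auto.
- intros n; split; [apply Cmod_ge_0 | apply H].
- apply is_lim_seq_const.
Qed.

Lemma Cconv_ext (s t : nat -> C) (l : C) :
  (forall n, s n = t n) -> Cconv s l -> Cconv t l.
Proof.
intros H; unfold Cconv; apply is_lim_seq_ext; intros n; now rewrite H.
Qed.

Lemma Cconv_const (c : C) : Cconv (fun _ => c) c.
Proof.
unfold Cconv; apply is_lim_seq_ext with (fun _ => 0%R).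
- intros n; replace (c - c) with (RtoC 0) by ring; now rewrite Cmod_0.
- apply is_lim_seq_const.
Qed.

Lemma Cconv_plus (s t : nat -> C) (l m : C) :
  Cconv s l -> Cconv t m -> Cconv (fun n => s n + t n) (l + m).
Proof.
intros Hs Ht.
apply Cconv_squeeze with (fun n => Cmod (s n - l) + Cmod (t n - m))%R.
- intros n; replace (s n + t n - (l + m)) with ((s n - l) + (t n - m)) by ring.
  apply Cmod_triangle.
- replace (Finite 0) with (Finite (0 + 0)) by (f_equal; ring).
  now apply is_lim_seq_plus'.
Qed.

Lemma Cconv_mult (s t : nat -> C) (l m : C) :
  Cconv s l -> Cconv t m -> Cconv (fun n => s n * t n) (l * m).
Proof.
intros Hs Ht.
apply Cconv_squeeze with (fun n =>
  Cmod (s n - l) * Cmod (t n - m) + (Cmod l * Cmod (t n - m) + Cmod m * Cmod (s n - l)))%R.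
- intros n.
  replace (s n * t n - l * m)
    with ((s n - l) * (t n - m) + (l * (t n - m) + m * (s n - l))) by ring.
  rewrite <- !Cmod_mult.
  eapply Rle_trans; [apply Cmod_triangle | apply Rplus_le_compat_l, Cmod_triangle].
- replace (Finite 0) with (Finite (0 * 0 + (Cmod l * 0 + Cmod m * 0))) by (f_equal; ring).
  apply is_lim_seq_plus'; [now apply is_lim_seq_mult' |].
  apply is_lim_seq_plus'; apply is_lim_seq_mult'; trivial; apply is_lim_seq_const.
Qed.

Lemma Cconv_unique (s : nat -> C) (l m : C) : Cconv s l -> Cconv s m -> l = m.
Proof.
intros Hl Hm.
assert (H : Cconv (fun _ => l - m) 0).
{ apply Cconv_squeeze with (fun n => Cmod (s n - l) + Cmod (s n - m))%R.
  - intros n; replace (l - m - 0) with (- (s n - l) + (s n - m)) by ring.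
    rewrite <- (Cmod_opp (s n - l)); apply Cmod_triangle.
  - replace (Finite 0) with (Finite (0 + 0)) by (f_equal; ring).
    now apply is_lim_seq_plus'. }
unfold Cconv in H; apply is_lim_seq_unique in H; rewrite Lim_seq_const in H.
assert (H1 : Cmod (l - m - 0) = 0%R) by congruence.
apply Cmod_eq_0 in H1.
replace l with ((l - m - 0) + m) by ring; rewrite H1; ring.
Qed.

Lemma Cconv_subseq (s : nat -> C) (l : C) (phi : nat -> nat) :
  (forall n, (n <= phi n)%nat) -> Cconv s l -> Cconv (fun n => s (phi n)) l.
Proof.
intros Hphi H; apply Cconv_eps; intros eps He.
destruct (proj1 (Cconv_eps _ _) H eps He) as [N HN]; exists N; intros n Hn.
apply HN; specialize (Hphi n); lia.
Qed.

Lemma Cconv_inv (s : nat -> C) (l : C) :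
  l <> 0 -> (forall n, s n <> 0) -> Cconv s l -> Cconv (fun n => / s n) (/ l).
Proof.
intros Hl Hs H.
assert (Hl' : (0 < Cmod l)%R) by now apply Cmod_gt_0.
apply Cconv_eps; intros eps He.
(* The first bound keeps |s n| above |l|/2; the second then gives |s n - l| < eps |l|^2 / 2 < eps |s
   n| |l|. *)
assert (He' : (0 < Rmin (Cmod l / 2) (eps * (Cmod l * Cmod l) / 2))%R).
{ apply Rmin_glb_lt; [lra |].
  assert (0 < eps * (Cmod l * Cmod l))%R by (repeat apply Rmult_lt_0_compat; lra).
  lra. }
destruct (proj1 (Cconv_eps _ _) H _ He') as [N HN]; exists N; intros n Hn.
specialize (HN n Hn).
assert (Hm : (Cmod l / 2 < Cmod (s n))%R).
{ assert (H1 : (Cmod l <= Cmod (s n) + Cmod (s n - l))%R).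
  { rewrite <- (Cmod_opp (s n - l)).
    eapply Rle_trans; [| apply Cmod_triangle]; right; f_equal; ring. }
  assert (H2 := Rmin_l (Cmod l / 2) (eps * (Cmod l * Cmod l) / 2)); lra. }
replace (/ s n - / l) with (- (s n - l) / (s n * l)) by (field; split; auto).
rewrite Cmod_div, Cmod_mult, Cmod_opp by (apply Cmult_neq_0; auto).
assert (Hp : (0 < Cmod (s n) * Cmod l)%R) by (apply Rmult_lt_0_compat; lra).
apply Rmult_lt_reg_r with (1 := Hp).
unfold Rdiv; rewrite Rmult_assoc, Rinv_l, Rmult_1_r by lra.
assert (H2 := Rmin_r (Cmod l / 2) (eps * (Cmod l * Cmod l) / 2)).
assert (H3 : (eps * (Cmod l / 2 * Cmod l) < eps * (Cmod (s n) * Cmod l))%R).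
{ apply Rmult_lt_compat_l; trivial; apply Rmult_lt_compat_r; trivial. }
lra.
Qed.

Lemma Cconv_bounded (s : nat -> C) (l : C) :
  Cconv s l -> exists B, (0 <= B)%R /\ forall n, (Cmod (s n) <= B)%R.
Proof.
intros H.
destruct (proj1 (Cconv_eps _ _) H 1%R Rlt_0_1) as [N HN].
assert (Hb : forall M, exists B, (0 <= B)%R /\ forall n, (n < M)%nat -> (Cmod (s n) <= B)%R).
{ induction M as [| M [B [HB0 HB]]].
  - exists 0%R; split; [lra | intros n Hn; lia].
  - exists (B + Cmod (s M))%R; split; [assert (H1 := Cmod_ge_0 (s M)); lra |].
    intros n Hn; destruct (Nat.eq_dec n M) as [-> | Hne]; [lra |].
    assert (H1 := Cmod_ge_0 (s M)); assert (Cmod (s n) <= B)%R by (apply HB; lia); lra. }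
destruct (Hb N) as [B [HB0 HB]].
exists (B + (Cmod l + 1))%R; assert (H1 := Cmod_ge_0 l); split; [lra |].
intros n; destruct (Nat.lt_ge_cases n N) as [Hn | Hn].
- specialize (HB n Hn); lra.
- specialize (HN n Hn).
  assert (Cmod (s n) <= Cmod (s n - l) + Cmod l)%R.
  { eapply Rle_trans; [| apply Cmod_triangle]; right; f_equal; ring. }
  lra.
Qed.

(** Completeness of C enters here: the increments form a series dominated by a geometric one, and
    its partial sums telescope. *)
Lemma Cconv_geometric (s : nat -> C) (K rho : R) :
  (0 <= rho < 1)%R ->
  (forall n, (Cmod (s (S n) - s n) <= K * rho ^ n)%R) ->
  exists l, Cconv s l.
Proof.
intros Hrho H.
assert (Hs : ex_series (V := C_NormedModule) (fun n => s (S n) - s n)).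
{ apply (@ex_series_le _ C_CompleteNormedModule _ (fun n => K * rho ^ n)%R).
  - exact H.
  - apply (ex_series_scal K (fun n => rho ^ n)%R), ex_series_geom.
    rewrite Rabs_pos_eq; lra. }
destruct Hs as [l Hl].
exists (s O + l).
assert (Hl' : Cconv (fun n => s (S n) - s O) l).
{ apply Cconv_filterlim.
  eapply filterlim_ext; [| exact Hl].
  intros n; induction n as [| n IH].
  - now rewrite sum_O.
  - rewrite sum_Sn, IH; change plus with Cplus; simpl; ring. }
apply Cconv_eps; intros eps He.
destruct (proj1 (Cconv_eps _ _) Hl' eps He) as [N HN]; exists (S N).
intros [| n] Hn; [lia |].
replace (s (S n) - (s O + l)) with (s (S n) - s O - l) by ring.
apply HN; lia.
Qed.

(** A three-epsilon argument: first fix K so that both [T K] and the distance from [L K] to [l0] are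
    small, then let N grow. *)
Lemma Cconv_interchange (S : nat -> nat -> C) (l L : nat -> C) (l0 : C) (T : nat -> R) :
  (forall K, exists N0, forall N, (N0 <= N)%nat -> (Cmod (l N - S K N) <= T K)%R) ->
  is_lim_seq T 0%R ->
  (forall K, Cconv (S K) (L K)) -> Cconv L l0 -> Cconv l l0.
Proof.
intros H HT HS HL; apply Cconv_eps; intros eps He.
assert (He3 : (0 < eps / 3)%R) by lra.
destruct (proj1 (Cconv_eps _ _) HL _ He3) as [K1 HK1].
apply is_lim_seq_spec in HT; destruct (HT (mkposreal _ He3)) as [K2 HK2]; simpl in HK2.
set (K := Nat.max K1 K2).
destruct (H K) as [N1 HN1].
destruct (proj1 (Cconv_eps _ _) (HS K) _ He3) as [N2 HN2].
exists (Nat.max N1 N2); intros N HN.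
assert (A1 := HN1 N ltac:(lia)).
assert (A2 := HN2 N ltac:(lia)).
assert (A3 := HK1 K ltac:(lia)).
assert (A4 := HK2 K ltac:(lia)).
rewrite Rminus_0_r in A4; assert (A5 := Rle_abs (T K)).
replace (l N - l0) with ((l N - S K N) + ((S K N - L K) + (L K - l0))) by ring.
eapply Rle_lt_trans; [apply Cmod_triangle |].
assert (A6 := Cmod_triangle (S K N - L K) (L K - l0)); lra.
Qed.

(** [lim] is a total operator, meaningful on Cauchy filters; convergence makes the filter Cauchy,
    and uniqueness of limits identifies its value. *)
Lemma cinfprod_eq (f : nat -> C) (l : C) : Cconv (cprod_upto f) l -> cinfprod f = l.
Proof.
intros H; unfold cinfprod.
assert (Hl : filterlim (cprod_upto f) eventually (@locally C_NormedModule l))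
  by now apply Cconv_filterlim.
apply Cconv_unique with (cprod_upto f); trivial.
apply Cconv_filterlim, filterlim_locally; intros eps.
apply (complete_cauchy (T := CompleteNormedModule.CompleteSpace _ C_CompleteNormedModule)
         (filtermap (cprod_upto f) eventually)).
- apply filtermap_proper_filter, eventually_filter.
- intros e; exists l; apply Hl; now exists e.
Qed.

(** * Sums over the integers *)

(* The sum of f over -N <= n < N. *)
Fixpoint zpart (f : Z -> C) (N : nat) : C :=
  match N with
  | O => 0
  | S M => zpart f M + (f (Z.of_nat M) + f (- 1 - Z.of_nat M)%Z)
  end.

Lemma zpart_S (f : Z -> C) (N : nat) :
  zpart f (S N) = zpart f N + (f (Z.of_nat N) + f (- 1 - Z.of_nat N)%Z).
Proof. reflexivity. Qed.

Definition zsum (f : Z -> C) (l : C) : Prop := Cconv (zpart f) l.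

(** One fixed rate serves all series below, since Gaussian terms decay faster than any geometric
    sequence. *)
Definition rho : R := exp (-1).

Definition decay (n : Z) : R := (rho ^ Z.abs_nat n)%R.

Definition decays (f : Z -> C) : Prop :=
  exists D, forall n, (Cmod (f n) <= D * decay n)%R.

(** Bounds the terms outside the window -K <= n < K of a series dominated by [D * decay n]: two
    geometric tails. *)
Definition tail (D : R) (K : nat) : R := (D * (2 / (1 - rho)) * rho ^ K)%R.

Lemma rho_bounds : (0 < rho < 1)%R.
Proof.
split; [apply exp_pos |].
rewrite <- exp_0; apply exp_increasing; lra.
Qed.

Lemma rho_pow_pos (n : nat) : (0 < rho ^ n)%R.
Proof. apply pow_lt, rho_bounds. Qed.

Lemma rho_pow_le (m n : nat) : (m <= n)%nat -> (rho ^ n <= rho ^ m)%R.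
Proof.
intros H; replace n with (m + (n - m))%nat by lia; rewrite pow_add.
rewrite <- (Rmult_1_r (rho ^ m)) at 2.
apply Rmult_le_compat_l; [left; apply rho_pow_pos |].
rewrite <- (pow1 (n - m)); apply pow_incr; destruct rho_bounds; lra.
Qed.

Lemma decay_pos (n : Z) : (0 < decay n)%R.
Proof. apply rho_pow_pos. Qed.

Lemma decays_bound (f : Z -> C) (D : R) :
  (forall n, (Cmod (f n) <= D * decay n)%R) -> (0 <= D)%R.
Proof.
intros H; specialize (H 0%Z); assert (H1 := Cmod_ge_0 (f 0%Z)).
unfold decay in H; simpl in H; lra.
Qed.

Lemma tail_lim (D : R) : is_lim_seq (tail D) 0%R.
Proof.
unfold tail.
replace (Finite 0) with (Rbar_mult (D * (2 / (1 - rho)))%R 0%R)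
  by (simpl; f_equal; ring).
apply is_lim_seq_scal_l, is_lim_seq_geom.
destruct rho_bounds; rewrite Rabs_pos_eq; lra.
Qed.

Lemma zpart_tail (f : Z -> C) (D : R) (K N : nat) :
  (forall n, (Cmod (f n) <= D * decay n)%R) -> (K <= N)%nat ->
  (Cmod (zpart f N - zpart f K) <= tail D K)%R.
Proof.
intros H HKN; assert (HD := decays_bound f D H).
destruct rho_bounds as [Hr0 Hr1].
(* Keeping the difference rho^K - rho^(K+j), the exact geometric sum, lets the induction close. *)
assert (Hj : forall j, (Cmod (zpart f (K + j) - zpart f K)
                        <= D * (2 / (1 - rho)) * (rho ^ K - rho ^ (K + j)))%R).
{ induction j as [| j IH].
  - rewrite Nat.add_0_r; replace (zpart f K - zpart f K) with (RtoC 0) by ring.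
    rewrite Cmod_0; lra.
  - rewrite Nat.add_succ_r, zpart_S.
    set (a := f (Z.of_nat (K + j))); set (b := f (- 1 - Z.of_nat (K + j))%Z).
    replace (zpart f (K + j) + (a + b) - zpart f K)
      with ((zpart f (K + j) - zpart f K) + (a + b)) by ring.
    assert (Ha : (Cmod a <= D * rho ^ (K + j))%R).
    { unfold a; eapply Rle_trans; [apply H |]; unfold decay; right; do 2 f_equal; lia. }
    assert (Hb : (Cmod b <= D * rho ^ (K + j))%R).
    { unfold b; eapply Rle_trans; [apply H |]; unfold decay.
      apply Rmult_le_compat_l; trivial; apply rho_pow_le; lia. }
    assert (H1 := Cmod_triangle (zpart f (K + j) - zpart f K) (a + b)).
    assert (H2 := Cmod_triangle a b).
    replace (D * (2 / (1 - rho)) * (rho ^ K - rho ^ S (K + j)))%R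
      with (D * (2 / (1 - rho)) * (rho ^ K - rho ^ (K + j)) + 2 * (D * rho ^ (K + j)))%R
      by (simpl; field; lra).
    lra. }
replace N with (K + (N - K))%nat by lia.
eapply Rle_trans; [apply Hj |].
unfold tail; apply Rmult_le_compat_l.
- apply Rmult_le_pos; trivial; apply Rmult_le_pos; [lra | left; apply Rinv_0_lt_compat; lra].
- assert (H1 := rho_pow_pos (K + (N - K))); lra.
Qed.

Lemma zpart_bound (f : Z -> C) (D : R) (N : nat) :
  (forall n, (Cmod (f n) <= D * decay n)%R) ->
  (Cmod (zpart f N) <= D * (2 / (1 - rho)))%R.
Proof.
intros H; assert (H1 := zpart_tail f D 0 N H ltac:(lia)).
unfold tail in H1; simpl in H1.
replace (zpart f N) with (zpart f N - 0) by ring; lra.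
Qed.

Lemma zsum_tail (f : Z -> C) (D : R) (l : C) (K : nat) :
  (forall n, (Cmod (f n) <= D * decay n)%R) -> zsum f l ->
  (Cmod (l - zpart f K) <= tail D K)%R.
Proof.
intros H Hl; apply le_epsilon; intros eps He.
destruct (proj1 (Cconv_eps _ _) Hl eps He) as [N HN].
specialize (HN (Nat.max N K) ltac:(lia)).
assert (H1 := zpart_tail f D K (Nat.max N K) H ltac:(lia)).
replace (l - zpart f K)
  with ((zpart f (Nat.max N K) - zpart f K) + - (zpart f (Nat.max N K) - l)) by ring.
eapply Rle_trans; [apply Cmod_triangle |]; rewrite Cmod_opp; lra.
Qed.

Lemma zsum_exists (f : Z -> C) : decays f -> exists l, zsum f l.
Proof.
intros [D H]; assert (HD := decays_bound f D H).
apply Cconv_geometric with (2 * D)%R rho; [destruct rho_bounds; lra |].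
intros n; rewrite zpart_S.
replace (zpart f n + (f (Z.of_nat n) + f (- 1 - Z.of_nat n)%Z) - zpart f n)
  with (f (Z.of_nat n) + f (- 1 - Z.of_nat n)%Z) by ring.
eapply Rle_trans; [apply Cmod_triangle |].
assert (H1 := H (Z.of_nat n)); assert (H2 := H (- 1 - Z.of_nat n)%Z).
unfold decay in *; rewrite Zabs2Nat.id in H1.
assert (H3 : (rho ^ Z.abs_nat (- 1 - Z.of_nat n) <= rho ^ n)%R) by (apply rho_pow_le; lia).
assert (H4 := Rmult_le_compat_l _ _ _ HD H3); lra.
Qed.

Lemma zpart_ext (f g : Z -> C) (N : nat) : (forall n, f n = g n) -> zpart f N = zpart g N.
Proof. intros H; induction N as [| N IH]; [| rewrite !zpart_S, IH, !H]; reflexivity. Qed.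

Lemma zpart_scal (c : C) (f : Z -> C) (N : nat) :
  zpart (fun n => c * f n) N = c * zpart f N.
Proof. induction N as [| N IH]; [simpl | rewrite !zpart_S, IH]; ring. Qed.

Lemma zpart_plus (f g : Z -> C) (N : nat) :
  zpart (fun n => f n + g n) N = zpart f N + zpart g N.
Proof. induction N as [| N IH]; [simpl | rewrite !zpart_S, IH]; ring. Qed.

Lemma zpart_exchange (g : Z -> Z -> C) (M N : nat) :
  zpart (fun i => zpart (g i) M) N = zpart (fun m => zpart (fun i => g i m) N) M.
Proof.
induction N as [| N IH].
- induction M as [| M IH]; [reflexivity | rewrite zpart_S, <- IH; simpl; ring].
- rewrite zpart_S, IH, <- !zpart_plus; apply zpart_ext; intros n; reflexivity.
Qed.

(** The window -N <= n < N moves one step to the right: it gains the index N and loses -N. *)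
Lemma zpart_shift (f : Z -> C) (N : nat) :
  zpart (fun n => f (n + 1)%Z) N = zpart f N + (f (Z.of_nat N) - f (- Z.of_nat N)%Z).
Proof.
induction N as [| N IH]; [simpl; ring |].
rewrite !zpart_S, IH.
replace (-1 - Z.of_nat N + 1)%Z with (- Z.of_nat N)%Z by lia.
replace (Z.of_nat N + 1)%Z with (Z.of_nat (S N)) by lia.
replace (- Z.of_nat (S N))%Z with (-1 - Z.of_nat N)%Z by lia.
ring.
Qed.

(** The asymmetric window pays off here: -2N <= n < 2N splits exactly into 2i and 2i+1 with -N <= i
    < N, without boundary terms. *)
Lemma zpart_parity (f : Z -> C) (N : nat) :
  zpart f (2 * N) = zpart (fun i => f (2 * i)%Z) N + zpart (fun i => f (2 * i + 1)%Z) N.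
Proof.
induction N as [| N IH]; [simpl; ring |].
replace (2 * S N)%nat with (S (S (2 * N))) by lia; rewrite !zpart_S, IH.
replace (Z.of_nat (2 * N)) with (2 * Z.of_nat N)%Z by lia.
replace (Z.of_nat (S (2 * N))) with (2 * Z.of_nat N + 1)%Z by lia.
replace (-1 - 2 * Z.of_nat N)%Z with (2 * (-1 - Z.of_nat N) + 1)%Z by lia.
replace (-1 - (2 * Z.of_nat N + 1))%Z with (2 * (-1 - Z.of_nat N))%Z by lia.
ring.
Qed.

Lemma zsum_ext (f g : Z -> C) (l : C) : (forall n, f n = g n) -> zsum f l -> zsum g l.
Proof. intros H; apply Cconv_ext; intros N; now apply zpart_ext. Qed.

Lemma zsum_scal (c : C) (f : Z -> C) (l : C) :
  zsum f l -> zsum (fun n => c * f n) (c * l).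
Proof.
intros H; apply Cconv_ext with (fun N => c * zpart f N).
- intros N; now rewrite zpart_scal.
- apply Cconv_mult; trivial; apply Cconv_const.
Qed.

Lemma zsum_plus (f g : Z -> C) (l m : C) :
  zsum f l -> zsum g m -> zsum (fun n => f n + g n) (l + m).
Proof.
intros Hf Hg; apply Cconv_ext with (fun N => zpart f N + zpart g N).
- intros N; now rewrite zpart_plus.
- now apply Cconv_plus.
Qed.

Lemma decays_ends (f : Z -> C) :
  decays f -> Cconv (fun N => f (Z.of_nat N) - f (- Z.of_nat N)%Z) 0.
Proof.
intros [D H]; apply Cconv_squeeze with (fun N => (2 * D) * rho ^ N)%R.
- intros N; assert (H1 := H (Z.of_nat N)); assert (H2 := H (- Z.of_nat N)%Z).
  unfold decay in *.
  replace (Z.abs_nat (- Z.of_nat N)) with N in H2 by lia; rewrite Zabs2Nat.id in H1.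
  replace (f (Z.of_nat N) - f (- Z.of_nat N)%Z - 0)
    with (f (Z.of_nat N) + - f (- Z.of_nat N)%Z) by ring.
  eapply Rle_trans; [apply Cmod_triangle |]; rewrite Cmod_opp; lra.
- replace (Finite 0) with (Rbar_mult (2 * D)%R 0%R) by (simpl; f_equal; ring).
  apply is_lim_seq_scal_l, is_lim_seq_geom.
  destruct rho_bounds; rewrite Rabs_pos_eq; lra.
Qed.

Lemma decay_shift (n k : Z) : (decay (n + k) <= / decay k * decay n)%R.
Proof.
assert (H := decay_pos k).
apply Rmult_le_reg_l with (1 := H).
rewrite <- Rmult_assoc, Rinv_r, Rmult_1_l by lra.
unfold decay; rewrite <- pow_add; apply rho_pow_le; lia.
Qed.

Lemma decays_shift (f : Z -> C) (k : Z) : decays f -> decays (fun n => f (n + k)%Z).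
Proof.
intros [D H]; assert (HD := decays_bound f D H).
exists (D * / decay k)%R; intros n.
eapply Rle_trans; [apply H |]; rewrite Rmult_assoc.
apply Rmult_le_compat_l; trivial; apply decay_shift.
Qed.

Lemma zsum_shift1 (f : Z -> C) (l : C) :
  decays f -> zsum f l <-> zsum (fun n => f (n + 1)%Z) l.
Proof.
intros Hf; assert (He := decays_ends f Hf); split; intros H.
- apply Cconv_ext with (fun N => zpart f N + (f (Z.of_nat N) - f (- Z.of_nat N)%Z)).
  + intros N; now rewrite zpart_shift.
  + replace l with (l + 0) by ring; now apply Cconv_plus.
- apply Cconv_ext with (fun N => zpart (fun n => f (n + 1)%Z) N
                                  + -1 * (f (Z.of_nat N) - f (- Z.of_nat N)%Z)).
  + intros N; rewrite zpart_shift; ring.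
  + replace l with (l + -1 * 0) by ring; apply Cconv_plus; trivial.
    apply Cconv_mult; trivial; apply Cconv_const.
Qed.

Lemma zsum_shift (f : Z -> C) (l : C) (k : Z) :
  decays f -> zsum f l -> zsum (fun n => f (n + k)%Z) l.
Proof.
intros Hf Hl.
assert (H0 : zsum (fun n => f (n + 0)%Z) l).
{ revert Hl; apply zsum_ext; intros n; f_equal; lia. }
(* Induction in both directions at once, which is possible because the shift by one is an
   equivalence. *)
revert k; apply Z.bi_induction; trivial.
- intros ? ? ->; reflexivity.
- intros k.
  rewrite (zsum_shift1 (fun n => f (n + k)%Z)) by now apply decays_shift.
  split; apply zsum_ext; intros n; f_equal; lia.
Qed.

(** Dominated convergence for series. The values [l N] enter only through a tail estimate, so they
    may be finite window sums or full sums over the integers. *)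
Lemma tannery (F : nat -> Z -> C) (f : Z -> C) (l : nat -> C) (l0 : C) (D : R) :
  (forall K, exists N0, forall N, (N0 <= N)%nat ->
     (Cmod (l N - zpart (F N) K) <= tail D K)%R) ->
  (forall n, Cconv (fun N => F N n) (f n)) -> zsum f l0 -> Cconv l l0.
Proof.
intros Hl HF Hf.
apply Cconv_interchange with (fun K N => zpart (F N) K) (zpart f) (tail D); trivial.
- apply tail_lim.
- induction K as [| K IH]; [exact (Cconv_const 0) |].
  exact (Cconv_plus _ _ _ _ IH (Cconv_plus _ _ _ _ (HF _) (HF _))).
Qed.

(** The product bound dominates the inner sums uniformly, so the two windows may grow at different
    speeds; windows 2N by 2N and N by 2N are compared later. *)
Lemma zpart_iterated (g : Z -> Z -> C) (r : Z -> C) (l : C) (D : R) (M1 M2 : nat -> nat) :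
  (forall N, (N <= M1 N)%nat) -> (forall N, (N <= M2 N)%nat) ->
  (forall i m, (Cmod (g i m) <= D * decay i * decay m)%R) ->
  (forall i, zsum (g i) (r i)) -> zsum r l ->
  Cconv (fun N => zpart (fun i => zpart (g i) (M2 N)) (M1 N)) l.
Proof.
intros H1 H2 Hg Hr Hl.
apply tannery with (F := fun N i => zpart (g i) (M2 N)) (f := r) (D := (D * (2 / (1 - rho)))%R);
  trivial.
- intros K; exists K; intros N HN.
  apply zpart_tail; [| specialize (H1 N); lia].
  intros i.
  replace (D * (2 / (1 - rho)) * decay i)%R with (D * decay i * (2 / (1 - rho)))%R by ring.
  apply zpart_bound; intros m; apply Hg.
- intros i; exact (Cconv_subseq _ _ M2 H2 (Hr i)).
Qed.

(* The rate 2 in the decay of [a] absorbs the shift, as |m| <= |i| + |m - i|. *)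
Lemma zpart_convolution (a b : Z -> C) (la lb : C) (D : R) (M1 M2 : nat -> nat) :
  (forall N, (N <= M1 N)%nat) -> (forall N, (N <= M2 N)%nat) ->
  (forall n, (Cmod (a n) <= D * (decay n * decay n))%R) -> decays b ->
  zsum a la -> zsum b lb ->
  Cconv (fun N => zpart (fun i => zpart (fun m => a i * b (m - i)%Z) (M2 N)) (M1 N))
    (la * lb).
Proof.
intros H1 H2 Ha Hb Hla Hlb; destruct Hb as [D' Hb].
assert (HD' := decays_bound b D' Hb).
apply zpart_iterated with (r := fun i => lb * a i) (D := (D * D')%R); trivial.
- intros i m; rewrite Cmod_mult.
  apply Rle_trans with (D * (decay i * decay i) * (D' * decay (m - i)))%R.
  { apply Rmult_le_compat; auto using Cmod_ge_0. }
  replace (D * (decay i * decay i) * (D' * decay (m - i)))%R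
    with (D * decay i * D' * (decay i * decay (m - i)))%R by ring.
  replace (D * D' * decay i * decay m)%R with (D * decay i * D' * decay m)%R by ring.
  assert (HD : (0 <= D * decay i)%R).
  { specialize (Ha i); assert (H3 := Cmod_ge_0 (a i)); assert (H4 := decay_pos i).
    rewrite <- Rmult_assoc in Ha.
    apply Rmult_le_reg_r with (1 := H4); lra. }
  apply Rmult_le_compat_l; [now apply Rmult_le_pos |].
  unfold decay; rewrite <- pow_add; apply rho_pow_le; lia.
- intros i; rewrite (Cmult_comm lb (a i)); apply zsum_scal.
  apply zsum_shift with (k := (- i)%Z) in Hlb; [exact Hlb | now exists D'].
- rewrite (Cmult_comm la lb); now apply zsum_scal.
Qed.

(** * Exponentials and infinite products *)

Lemma cexp_plus (a b : C) : cexp (a + b) = cexp a * cexp b.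
Proof.
destruct a as [a1 a2], b as [b1 b2]; unfold cexp; simpl.
rewrite exp_plus, cos_plus, sin_plus; unfold Cmult; simpl; f_equal; ring.
Qed.

Lemma cexp_0 : cexp 0 = 1.
Proof. unfold cexp; simpl; rewrite exp_0, cos_0, sin_0; unfold RtoC; f_equal; ring. Qed.

Lemma Cmod_cexp (z : C) : Cmod (cexp z) = exp (Re z).
Proof.
unfold Cmod, cexp; simpl.
replace (exp (Re z) * cos (Im z) * (exp (Re z) * cos (Im z) * 1) +
         exp (Re z) * sin (Im z) * (exp (Re z) * sin (Im z) * 1))%R
  with (exp (Re z) * exp (Re z) * (Rsqr (sin (Im z)) + Rsqr (cos (Im z))))%R
  by (unfold Rsqr; ring).
rewrite sin2_cos2, Rmult_1_r; apply sqrt_square; left; apply exp_pos.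
Qed.

Lemma cexp_neq0 (z : C) : cexp z <> 0.
Proof. apply Cmod_gt_0; rewrite Cmod_cexp; apply exp_pos. Qed.

Lemma cexp_opp (z : C) : cexp (- z) = / cexp z.
Proof.
assert (H := cexp_neq0 z).
replace (/ cexp z) with (cexp (z + - z) * / cexp z).
- rewrite cexp_plus; field; trivial.
- replace (z + - z) with (RtoC 0) by ring; rewrite cexp_0; ring.
Qed.

Lemma cexp_minus (a b : C) : cexp (a - b) = cexp a / cexp b.
Proof. unfold Cminus; now rewrite cexp_plus, cexp_opp. Qed.

Lemma cexp_mul_nat (n : nat) (z : C) : cexp (RtoC (INR n) * z) = cexp z ^ n.
Proof.
induction n as [| n IH].
- replace (RtoC (INR 0) * z) with (RtoC 0) by (simpl; ring); apply cexp_0.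
- rewrite S_INR, RtoC_plus.
  replace ((RtoC (INR n) + 1) * z) with (RtoC (INR n) * z + z) by ring.
  rewrite cexp_plus, IH; simpl; ring.
Qed.

(** A logarithm of -1: in the additive variables used throughout, a change of sign becomes a
    shift. *)
Definition i_pi : C := (0%R, PI).

Lemma cexp_i_pi : cexp i_pi = -1.
Proof.
unfold cexp, i_pi; simpl; rewrite exp_0, cos_PI, sin_PI.
unfold Copp, RtoC; simpl; f_equal; ring.
Qed.

Lemma cexp_add_i_pi (z : C) : cexp (z + i_pi) = - cexp z.
Proof. rewrite cexp_plus, cexp_i_pi; ring. Qed.

Lemma cexp_sub_i_pi (z : C) : cexp (z - i_pi) = - cexp z.
Proof.
replace (cexp z) with (cexp ((z - i_pi) + i_pi)) by (f_equal; ring).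
rewrite cexp_add_i_pi; ring.
Qed.

Definition CZ (n : Z) : C := RtoC (IZR n).

Lemma CZ_add (m n : Z) : CZ (m + n) = CZ m + CZ n.
Proof. unfold CZ; now rewrite plus_IZR, RtoC_plus. Qed.

Lemma CZ_sub (m n : Z) : CZ (m - n) = CZ m - CZ n.
Proof. unfold CZ; now rewrite minus_IZR, RtoC_minus. Qed.

Lemma CZ_mul (m n : Z) : CZ (m * n) = CZ m * CZ n.
Proof. unfold CZ; now rewrite mult_IZR, RtoC_mult. Qed.

Lemma CZ_of_nat (n : nat) : CZ (Z.of_nat n) = RtoC (INR n).
Proof. unfold CZ; now rewrite INR_IZR_INZ. Qed.

Lemma cexp_2ipi (n : Z) : cexp (CZ n * (2 * i_pi)) = 1.
Proof.
assert (H : forall k : nat, cexp (RtoC (INR k) * (2 * i_pi)) = 1).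
{ intros k; rewrite cexp_mul_nat.
  replace (2 * i_pi) with (0 + i_pi + i_pi) by ring.
  rewrite !cexp_add_i_pi, cexp_0.
  induction k as [| k IH]; simpl; [| rewrite IH]; ring. }
destruct (Z_le_gt_dec 0 n) as [Hn | Hn].
- replace n with (Z.of_nat (Z.to_nat n)) by lia; rewrite CZ_of_nat; apply H.
- replace n with (0 - Z.of_nat (Z.to_nat (- n)))%Z by lia.
  rewrite CZ_sub, CZ_of_nat.
  replace ((CZ 0 - RtoC (INR (Z.to_nat (- n)))) * (2 * i_pi))
    with (- (RtoC (INR (Z.to_nat (- n))) * (2 * i_pi))) by (unfold CZ; ring).
  rewrite cexp_opp, H; field.
Qed.

Lemma cexp_add_2ipi (z : C) (n : Z) : cexp (z + CZ n * (2 * i_pi)) = cexp z.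
Proof. rewrite cexp_plus, cexp_2ipi; ring. Qed.

Lemma decay_exp (n : Z) : decay n = exp (- IZR (Z.abs n)).
Proof.
unfold decay, rho; rewrite <- Zabs2Nat.id_abs, <- INR_IZR_INZ.
induction (Z.abs_nat n) as [| k IH]; [simpl; now rewrite Ropp_0, exp_0 |].
rewrite S_INR; simpl; rewrite IH, <- exp_plus; f_equal; ring.
Qed.

(** Completing the square: Re a s^2 + k s has maximum k^2 / (-4 Re a). The summand 2 in k supplies
    the factor e^{-2|n|}, that is, the squared decay used in convolutions. *)
Lemma gaussian_decay (a z : C) :
  (Re a < 0)%R ->
  exists D, forall n, (Cmod (cexp (a * (CZ n * CZ n) + CZ n * z)) <= D * (decay n * decay n))%R.
Proof.
intros Ha; set (k := (Rabs (Re z) + 2)%R).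
exists (exp (k * k / (-4 * Re a))); intros n.
rewrite Cmod_cexp, decay_exp, <- !exp_plus.
replace (Re (a * (CZ n * CZ n) + CZ n * z)) with (Re a * (IZR n * IZR n) + IZR n * Re z)%R
  by (destruct a, z; unfold CZ; simpl; ring).
set (s := IZR (Z.abs n)).
assert (Hs : s = Rabs (IZR n)) by (unfold s; now rewrite abs_IZR).
replace (IZR n * IZR n)%R with (s * s)%R
  by (rewrite Hs; destruct (Rcase_abs (IZR n)) as [H | H];
      [rewrite Rabs_left | rewrite Rabs_right]; trivial; ring).
assert (H1 : (IZR n * Re z <= s * Rabs (Re z))%R).
{ rewrite Hs, <- Rabs_mult; apply Rle_abs. }
assert (H2 : (Re a * (s * s) + s * k <= k * k / (-4 * Re a))%R).
{ apply Rmult_le_reg_r with (-4 * Re a)%R; [lra |].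
  replace (k * k / (-4 * Re a) * (-4 * Re a))%R with (k * k)%R by (field; lra).
  assert (H3 := Rle_0_sqr (2 * Re a * s + k)); unfold Rsqr in H3; lra. }
assert (H4 : (Re a * (s * s) + IZR n * Re z <= k * k / (-4 * Re a) + (- s + - s))%R)
  by (unfold k in *; lra).
destruct H4 as [H4 | H4]; [left; now apply exp_increasing | right; now rewrite H4].
Qed.

Lemma gaussian_decays (a z : C) :
  (Re a < 0)%R -> decays (fun n => cexp (a * (CZ n * CZ n) + CZ n * z)).
Proof.
intros Ha; destruct (gaussian_decay a z Ha) as [D HD]; exists D; intros n.
assert (H0 := HD 0%Z); assert (H1 := Cmod_ge_0 (cexp (a * (CZ 0 * CZ 0) + CZ 0 * z))).
assert (HD0 : (0 <= D)%R) by (unfold decay in H0; simpl in H0; lra).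
eapply Rle_trans; [apply HD |].
apply Rmult_le_compat_l; trivial.
unfold decay; rewrite <- pow_add; apply rho_pow_le; lia.
Qed.

(** * Partial products and convergence of infinite products *)

Lemma cprod_ext (f g : nat -> C) (N : nat) :
  (forall k, f k = g k) -> cprod_upto f N = cprod_upto g N.
Proof. intros H; induction N as [| N IH]; simpl; [| rewrite IH, H]; reflexivity. Qed.

Lemma cprod_mult (f g : nat -> C) (N : nat) :
  cprod_upto (fun k => f k * g k) N = cprod_upto f N * cprod_upto g N.
Proof. induction N as [| N IH]; simpl; [| rewrite IH]; ring. Qed.

Lemma cprod_add (f : nat -> C) (M N : nat) :
  cprod_upto f (M + N) = cprod_upto f M * cprod_upto (fun k => f (M + k)%nat) N.
Proof.
induction N as [| N IH]; [rewrite Nat.add_0_r; simpl; ring |].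
rewrite Nat.add_succ_r; simpl; rewrite IH; ring.
Qed.

Lemma cprod_blocks (f : nat -> C) (m N : nat) :
  cprod_upto f (m * N)
  = cprod_upto (fun j => cprod_upto (fun k => f (m * k + j)%nat) N) m.
Proof.
induction N as [| N IH].
- rewrite Nat.mul_0_r; simpl; induction m as [| m IH]; simpl; [| rewrite <- IH]; ring.
- replace (m * S N)%nat with (m * N + m)%nat by lia.
  rewrite cprod_add, IH, <- cprod_mult; reflexivity.
Qed.

Lemma cprod_neq0 (f : nat -> C) (N : nat) :
  (forall k, f k <> 0) -> cprod_upto f N <> 0.
Proof.
intros H; induction N as [| N IH]; simpl.
- apply C1_nz.
- now apply Cmult_neq_0.
Qed.

Lemma cprod_conv (c : nat -> C) (K r : R) :
  (0 <= r < 1)%R -> (forall k, (Cmod (c k) <= K * r ^ k)%R) ->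
  exists l, Cconv (cprod_upto (fun k => 1 - c k)) l.
Proof.
intros Hr Hc.
assert (HK : (0 <= K)%R).
{ specialize (Hc O); assert (H := Cmod_ge_0 (c O)); simpl in Hc; lra. }
(* From |1 - c| <= 1 + |c| <= e^{|c|} and the geometric sum the partial products are bounded, hence
   their increments are geometrically small. *)
assert (Hb : forall N, (Cmod (cprod_upto (fun k => (1 - c k)%C) N)
                        <= exp (K * ((1 - r ^ N) / (1 - r))))%R).
{ induction N as [| N IH].
  - simpl; rewrite Cmod_1.
    replace (K * ((1 - 1) / (1 - r)))%R with 0%R by (field; lra); rewrite exp_0; lra.
  - simpl cprod_upto; rewrite Cmod_mult.
    replace (K * ((1 - r ^ S N) / (1 - r)))%R
      with (K * ((1 - r ^ N) / (1 - r)) + K * r ^ N)%R by (simpl; field; lra).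
    rewrite exp_plus; apply Rmult_le_compat; auto using Cmod_ge_0.
    apply Rle_trans with (1 + K * r ^ N)%R; [| apply exp_ineq1_le].
    eapply Rle_trans; [apply Cmod_triangle |]; rewrite Cmod_1, Cmod_opp.
    apply Rplus_le_compat_l, Hc. }
apply Cconv_geometric with (exp (K / (1 - r)) * K)%R r; trivial.
intros N; simpl.
set (p := cprod_upto (fun k => 1 - c k) N).
replace (p * (1 - c N) - p) with (- (p * c N)) by ring.
rewrite Cmod_opp, Cmod_mult, Rmult_assoc.
apply Rmult_le_compat; auto using Cmod_ge_0.
eapply Rle_trans; [apply Hb |].
assert (Hle : (K * ((1 - r ^ N) / (1 - r)) <= K / (1 - r))%R).
{ assert (H0 : (0 <= r ^ N)%R) by (apply pow_le; lra).
  assert (H1 : (0 <= K / (1 - r))%R)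
    by (apply Rmult_le_pos; trivial; left; apply Rinv_0_lt_compat; lra).
  replace (K * ((1 - r ^ N) / (1 - r)))%R with (K / (1 - r) - K / (1 - r) * r ^ N)%R
    by (field; lra).
  assert (H2 := Rmult_le_pos _ _ H1 H0); lra. }
destruct Hle as [H | H]; [left; now apply exp_increasing | right; now rewrite H].
Qed.

(** Weierstrass's inequality: a product of factors 1 - |c k| is at least 1 minus the sum of the |c
    k|, here at most e/(1-r) <= 1/2. *)
Lemma cprod_lower (c : nat -> C) (e r : R) (N : nat) :
  (0 <= r < 1)%R -> (e / (1 - r) <= 1 / 2)%R -> (forall k, (Cmod (c k) <= e * r ^ k)%R) ->
  (1 / 2 <= Cmod (cprod_upto (fun k => (1 - c k)%C) N))%R.
Proof.
intros Hr He Hc.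
assert (He0 : (0 <= e)%R).
{ specialize (Hc O); assert (H := Cmod_ge_0 (c O)); simpl in Hc; lra. }
assert (Hinv : (0 < / (1 - r))%R) by (apply Rinv_0_lt_compat; lra).
assert (Hrk : forall k, (0 <= r ^ k <= 1)%R).
{ intros k; split; [apply pow_le; lra | rewrite <- (pow1 k); apply pow_incr; lra]. }
assert (H0 : (0 <= e / (1 - r))%R) by (apply Rmult_le_pos; lra).
assert (He1 : (e <= e / (1 - r))%R).
{ replace (e / (1 - r))%R with (e + e / (1 - r) * r)%R by (field; lra).
  assert (H1 : (0 <= e / (1 - r) * r)%R) by (apply Rmult_le_pos; lra); lra. }
assert (H : (1 - e / (1 - r) * (1 - r ^ N) <= Cmod (cprod_upto (fun k => (1 - c k)%C) N))%R).
{ induction N as [| N IH]; simpl.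
  - rewrite Cmod_1; lra.
  - rewrite Cmod_mult.
    set (S := (e / (1 - r) * (1 - r ^ N))%R) in *.
    assert (HS : (0 <= S)%R) by (apply Rmult_le_pos; trivial; specialize (Hrk N); lra).
    assert (Hcn : (0 <= Cmod (c N) <= e * r ^ N)%R) by (split; [apply Cmod_ge_0 | apply Hc]).
    assert (Hle : (e * r ^ N <= e)%R).
    { rewrite <- (Rmult_1_r e) at 2; apply Rmult_le_compat_l; trivial; apply Hrk. }
    assert (H1 : (1 - Cmod (c N) <= Cmod (1 - c N))%R).
    { assert (H2 := Cmod_triangle (1 - c N) (c N)).
      replace (1 - c N + c N) with (RtoC 1) in H2 by ring; rewrite Cmod_1 in H2; lra. }
    replace (e / (1 - r) * (1 - r * r ^ N))%R with (S + e * r ^ N)%R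
      by (unfold S; field; lra).
    assert (HS1 : (S <= 1)%R).
    { unfold S; apply Rle_trans with (e / (1 - r) * 1)%R; [| lra].
      apply Rmult_le_compat_l; trivial; specialize (Hrk N); lra. }
    apply Rle_trans with ((1 - S) * (1 - Cmod (c N)))%R.
    + assert (H2 : (0 <= S * Cmod (c N))%R) by (apply Rmult_le_pos; lra); lra.
    + apply Rmult_le_compat; lra. }
assert (H1 : (0 <= e / (1 - r) * r ^ N)%R) by (apply Rmult_le_pos; trivial; apply Hrk).
lra.
Qed.

(** Beyond a suitable M the remaining product has modulus at least 1/2 by [cprod_lower], while the
    first M factors are nonzero. *)
Lemma cprod_conv_neq0 (c : nat -> C) (K r : R) (l : C) :
  (0 <= r < 1)%R -> (forall k, (Cmod (c k) <= K * r ^ k)%R) -> (forall k, c k <> 1) ->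
  Cconv (cprod_upto (fun k => 1 - c k)) l -> l <> 0.
Proof.
intros Hr Hc Hc1 Hl.
assert (HM : exists M, (K * r ^ M / (1 - r) <= 1 / 2)%R).
{ assert (HL : is_lim_seq (fun n => K / (1 - r) * r ^ n)%R 0%R).
  { replace (Finite 0) with (Rbar_mult (K / (1 - r))%R 0%R) by (simpl; f_equal; ring).
    apply is_lim_seq_scal_l, is_lim_seq_geom; rewrite Rabs_pos_eq; lra. }
  apply is_lim_seq_spec in HL.
  assert (Hh : (0 < 1 / 2)%R) by lra.
  destruct (HL (mkposreal _ Hh)) as [M HM]; exists M.
  specialize (HM M ltac:(lia)); simpl in HM; rewrite Rminus_0_r in HM.
  replace (K * r ^ M / (1 - r))%R with (K / (1 - r) * r ^ M)%R by (field; lra).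
  assert (H := Rle_abs (K / (1 - r) * r ^ M)); lra. }
destruct HM as [M HM].
assert (Hnz : cprod_upto (fun k => 1 - c k) M <> 0).
{ apply cprod_neq0; intros k H; apply (Hc1 k).
  replace (c k) with (1 - (1 - c k)) by ring; rewrite H; ring. }
apply Cmod_gt_0 in Hnz; set (p := cprod_upto (fun k => 1 - c k) M) in *.
intros ->.
destruct (proj1 (Cconv_eps _ _) Hl (Cmod p * (1 / 2))%R ltac:(lra)) as [N HN].
specialize (HN (M + N)%nat ltac:(lia)).
assert (E : forall z : C, z - 0 = z) by (intros z; ring).
rewrite E, cprod_add, Cmod_mult in HN; fold p in HN.
apply Rmult_lt_reg_l in HN; trivial.
assert (H := cprod_lower (fun k => c (M + k)%nat) (K * r ^ M) r N Hr HM).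
apply (Rlt_not_le _ _ HN), H.
intros k; rewrite Rmult_assoc, <- pow_add; apply Hc.
Qed.

(** The q-Pochhammer symbol (e^x; e^P) of infinite length, in logarithmic variables. *)
Definition qp (x P : C) : C := cinfprod (fun k => 1 - cexp (x + RtoC (INR k) * P)).

Definition qp_upto (x P : C) (N : nat) : C :=
  cprod_upto (fun k => 1 - cexp (x + RtoC (INR k) * P)) N.

Lemma qp_upto_S (x P : C) (N : nat) :
  qp_upto x P (S N) = qp_upto x P N * (1 - cexp (x + RtoC (INR N) * P)).
Proof. reflexivity. Qed.

Lemma Cmod_cexp_progression (x P : C) (k : nat) :
  Cmod (cexp (x + RtoC (INR k) * P)) = (exp (Re x) * exp (Re P) ^ k)%R.
Proof.
rewrite cexp_plus, Cmod_mult, cexp_mul_nat, Cmod_pow, !Cmod_cexp; reflexivity.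
Qed.

Lemma exp_neg_bounds (a : R) : (a < 0)%R -> (0 <= exp a < 1)%R.
Proof.
intros Ha; split; [left; apply exp_pos | rewrite <- exp_0; now apply exp_increasing].
Qed.

Lemma qp_conv (x P : C) : (Re P < 0)%R -> Cconv (qp_upto x P) (qp x P).
Proof.
intros HP.
destruct (cprod_conv (fun k => cexp (x + RtoC (INR k) * P)) (exp (Re x)) (exp (Re P)))
  as [l Hl].
- now apply exp_neg_bounds.
- intros k; rewrite Cmod_cexp_progression; lra.
- unfold qp; rewrite (cinfprod_eq _ l Hl); exact Hl.
Qed.

Lemma cexp_neq1 (x : C) : (Re x < 0)%R -> cexp x <> 1.
Proof.
intros Hx H; apply (f_equal Cmod) in H; rewrite Cmod_cexp, Cmod_1 in H.
assert (H1 := exp_neg_bounds _ Hx); lra.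
Qed.

Lemma Re_progression (x P : C) (k : nat) :
  (Re x < 0)%R -> (Re P < 0)%R -> (Re (x + RtoC (INR k) * P) < 0)%R.
Proof.
intros Hx HP; destruct x as [x1 x2], P as [p1 p2]; simpl in *.
assert (H := pos_INR k).
assert (H1 : (0 <= INR k * - p1)%R) by (apply Rmult_le_pos; lra); lra.
Qed.

Lemma qp_upto_neq0 (x P : C) (N : nat) : (Re x < 0)%R -> (Re P < 0)%R -> qp_upto x P N <> 0.
Proof.
intros Hx HP; apply cprod_neq0; intros k H.
apply (cexp_neq1 _ (Re_progression x P k Hx HP)).
replace (cexp (x + RtoC (INR k) * P)) with (1 - (1 - cexp (x + RtoC (INR k) * P))) by ring.
rewrite H; ring.
Qed.

Lemma qp_neq0 (x P : C) : (Re x < 0)%R -> (Re P < 0)%R -> qp x P <> 0.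
Proof.
intros Hx HP.
apply cprod_conv_neq0
  with (c := fun k => cexp (x + RtoC (INR k) * P)) (K := exp (Re x)) (r := exp (Re P)).
- now apply exp_neg_bounds.
- intros k; rewrite Cmod_cexp_progression; lra.
- intros k; apply cexp_neq1; now apply Re_progression.
- now apply qp_conv.
Qed.

Lemma qp_step (x P : C) : (Re P < 0)%R -> qp x P = (1 - cexp x) * qp (x + P) P.
Proof.
intros HP; apply Cconv_unique with (fun N => qp_upto x P (S N)).
- apply (Cconv_subseq (qp_upto x P) _ S); [lia | now apply qp_conv].
- apply Cconv_ext with (fun N => (1 - cexp x) * qp_upto (x + P) P N).
  + intros N; unfold qp_upto; change (S N) with (1 + N)%nat; rewrite cprod_add; f_equal.
    * simpl; replace (x + 0 * P) with x by ring; ring.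
    * apply cprod_ext; intros k; do 2 f_equal.
      rewrite plus_INR, RtoC_plus; simpl; ring.
  + apply Cconv_mult; [apply Cconv_const | now apply qp_conv].
Qed.

Lemma qp_ext (x y P : C) : (Re P < 0)%R -> cexp x = cexp y -> qp x P = qp y P.
Proof.
intros HP H; apply Cconv_unique with (qp_upto x P); [now apply qp_conv |].
apply Cconv_ext with (qp_upto y P); [| now apply qp_conv].
intros N; apply cprod_ext; intros k; now rewrite !cexp_plus, H.
Qed.

Lemma Cconv_cprod (s : nat -> nat -> C) (l : nat -> C) (m : nat) :
  (forall j, Cconv (fun N => s N j) (l j)) ->
  Cconv (fun N => cprod_upto (s N) m) (cprod_upto l m).
Proof.
intros H; induction m as [| m IH]; [exact (Cconv_const 1) |].
exact (Cconv_mult _ _ _ _ IH (H m)).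
Qed.

(** Dissection of the index by residues modulo m; used with m = 2 for the duplication formula and m
    = 7 for eta. *)
Lemma qp_split (x P : C) (m : nat) :
  (0 < m)%nat -> (Re P < 0)%R ->
  qp x P = cprod_upto (fun j => qp (x + RtoC (INR j) * P) (RtoC (INR m) * P)) m.
Proof.
intros Hm HP.
assert (HmP : (Re (RtoC (INR m) * P) < 0)%R).
{ assert (H := lt_0_INR m Hm); destruct P as [p1 p2]; simpl in *.
  assert (H1 : (0 < INR m * - p1)%R) by (apply Rmult_lt_0_compat; lra); lra. }
apply Cconv_unique with (fun N => qp_upto x P (m * N)).
- apply (Cconv_subseq (qp_upto x P) _ (fun N => m * N)%nat); [nia | now apply qp_conv].
- apply Cconv_ext with
    (fun N => cprod_upto (fun j => qp_upto (x + RtoC (INR j) * P) (RtoC (INR m) * P) N) m).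
  + intros N; unfold qp_upto; rewrite cprod_blocks.
    apply cprod_ext; intros j; apply cprod_ext; intros k; do 2 f_equal.
    rewrite plus_INR, mult_INR, RtoC_plus, RtoC_mult; ring.
  + apply (Cconv_cprod (fun N j => qp_upto (x + RtoC (INR j) * P) (RtoC (INR m) * P) N)).
    intros j; now apply qp_conv.
Qed.

(** * The Jacobi triple product *)

Lemma Re_double (R : C) : (Re R < 0)%R -> (Re (2 * R) < 0)%R.
Proof. destruct R as [a b]; simpl; lra. Qed.

(* 1/(p;p)_n for the base p = e^{2R}, extended by 0 to negative n. *)
Definition ipoch (R : C) (n : Z) : C :=
  if (n <? 0)%Z then 0 else / qp_upto (2 * R) (2 * R) (Z.to_nat n).

(** The extension by 0 makes the recurrence valid for every integer: at n = 0 the factor 1 - p^0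
    vanishes, as does [ipoch R (-1)]. *)
Lemma ipoch_pred (R : C) (n : Z) :
  (Re R < 0)%R -> ipoch R (n - 1) = (1 - cexp (CZ n * (2 * R))) * ipoch R n.
Proof.
intros HR; apply Re_double in HR; unfold ipoch.
destruct (Z.ltb_spec n 0) as [Hn | Hn].
- destruct (Z.ltb_spec (n - 1) 0); [ring | lia].
- destruct (Z.eq_dec n 0) as [-> | Hn0].
  + simpl; replace (CZ 0 * (2 * R)) with (RtoC 0) by (unfold CZ; ring).
    rewrite cexp_0; ring.
  + destruct (Z.ltb_spec (n - 1) 0); [lia |].
    set (m := Z.to_nat (n - 1)).
    replace (Z.to_nat n) with (S m) by lia.
    assert (H1 := qp_upto_neq0 (2 * R) (2 * R) m HR HR).
    assert (H2 := qp_upto_neq0 (2 * R) (2 * R) (S m) HR HR).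
    rewrite qp_upto_S in *.
    replace (CZ n * (2 * R)) with (2 * R + RtoC (INR m) * (2 * R)).
    * field; split; trivial.
      intros H3; apply H2; rewrite H3; ring.
    * replace n with (Z.of_nat m + 1)%Z by lia.
      rewrite CZ_add, CZ_of_nat; unfold CZ; ring.
Qed.

Lemma ipoch_bounded (R : C) :
  (Re R < 0)%R -> exists B, (0 <= B)%R /\ forall n, (Cmod (ipoch R n) <= B)%R.
Proof.
intros HR; apply Re_double in HR.
destruct (Cconv_bounded (fun n => / qp_upto (2 * R) (2 * R) n) (/ qp (2 * R) (2 * R)))
  as [B [HB0 HB]].
- apply Cconv_inv; [now apply qp_neq0 | intros n; now apply qp_upto_neq0 | now apply qp_conv].
- exists B; split; trivial; intros n; unfold ipoch.
  destruct (n <? 0)%Z; [now rewrite Cmod_0 | apply HB].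
Qed.

Lemma ipoch_conv (R : C) (m : Z) :
  (Re R < 0)%R ->
  Cconv (fun N => ipoch R (Z.of_nat N + m)) (/ qp (2 * R) (2 * R)).
Proof.
intros HR; apply Re_double in HR.
assert (H : Cconv (fun n => / qp_upto (2 * R) (2 * R) n) (/ qp (2 * R) (2 * R))).
{ apply Cconv_inv; [now apply qp_neq0 | intros n; now apply qp_upto_neq0 | now apply qp_conv]. }
apply Cconv_eps; intros eps He.
destruct (proj1 (Cconv_eps _ _) H eps He) as [N0 HN0].
exists (N0 + Z.abs_nat m)%nat; intros N HN; unfold ipoch.
destruct (Z.ltb_spec (Z.of_nat N + m) 0); [lia |].
apply HN0; lia.
Qed.

(** With p = e^{2R} this is p^{n(n-1)/2} e^{nz}. *)
Definition jterm (R z : C) (n : Z) : C := cexp (R * (CZ n * (CZ n - 1)) + CZ n * z).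

Lemma jterm_gaussian (R z : C) (n : Z) :
  jterm R z n = cexp (R * (CZ n * CZ n) + CZ n * (z - R)).
Proof. unfold jterm; f_equal; ring. Qed.

Lemma jterm_decay (R z : C) :
  (Re R < 0)%R -> exists D, forall n, (Cmod (jterm R z n) <= D * (decay n * decay n))%R.
Proof.
intros HR; destruct (gaussian_decay R (z - R) HR) as [D HD]; exists D.
intros n; rewrite jterm_gaussian; apply HD.
Qed.

Lemma jterm_decays (R z : C) : (Re R < 0)%R -> decays (jterm R z).
Proof.
intros HR; destruct (gaussian_decays R (z - R) HR) as [D HD]; exists D.
intros n; rewrite jterm_gaussian; apply HD.
Qed.

Lemma jterm_pred (R z : C) (n : Z) :
  cexp z * jterm R z (n - 1) = jterm R z n * cexp (2 * R) / cexp (CZ n * (2 * R)).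
Proof.
unfold jterm; rewrite <- cexp_plus, <- cexp_plus, <- cexp_minus; f_equal.
rewrite CZ_sub; unfold CZ; ring.
Qed.

Lemma jterm_succ (R z : C) (n : Z) :
  jterm R z (n + 1) / cexp z = jterm R z n * cexp (CZ n * (2 * R)).
Proof.
unfold jterm; rewrite <- cexp_plus, <- cexp_minus; f_equal.
rewrite CZ_add; unfold CZ; ring.
Qed.

(* Up to the factor (p;p)_{2N}, the coefficients of the finite Jacobi product
   (x;p)_N (p/x;p)_N: the Gaussian binomial [2N, N+n] is
   (p;p)_{2N} / ((p;p)_{N+n} (p;p)_{N-n}). *)
Definition finite_jterm (R z : C) (N : nat) (n : Z) : C :=
  ipoch R (Z.of_nat N + n) * ipoch R (Z.of_nat N - n) * jterm R z n.

Lemma finite_jterm_bound (R z : C) :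
  (Re R < 0)%R -> exists D, forall N n, (Cmod (finite_jterm R z N n) <= D * decay n)%R.
Proof.
intros HR; destruct (ipoch_bounded R HR) as [B [HB0 HB]].
destruct (jterm_decays R z HR) as [D HD].
exists (B * B * D)%R; intros N n; unfold finite_jterm; rewrite !Cmod_mult.
rewrite (Rmult_assoc (B * B)).
apply Rmult_le_compat; auto using Cmod_ge_0.
- rewrite <- Cmod_mult; apply Cmod_ge_0.
- apply Rmult_le_compat; auto using Cmod_ge_0.
Qed.

Lemma finite_jterm_decays (R z : C) (N : nat) : (Re R < 0)%R -> decays (finite_jterm R z N).
Proof. intros HR; destruct (finite_jterm_bound R z HR) as [D HD]; exists D; apply HD. Qed.

(** With Y = p^N this compares the coefficients of e^{nz} when the finite product is multiplied by
    its next factors (1 + Y e^z)(1 + Y p / e^z); the left factor is (p;p)_{2N+2} / (p;p)_{2N}. *)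
Lemma finite_jterm_step (R z : C) (N : nat) (n : Z) :
  (Re R < 0)%R ->
  let p := cexp (2 * R) in
  let Y := cexp (RtoC (INR N) * (2 * R)) in
  (1 - Y * Y * p) * (1 - Y * Y * p * p) * finite_jterm R z (S N) n
  = (1 + Y * Y * p) * finite_jterm R z N n + Y * cexp z * finite_jterm R z N (n - 1)
    + Y * p / cexp z * finite_jterm R z N (n + 1).
Proof.
intros HR p Y; unfold finite_jterm.
replace (Z.of_nat N + (n + 1))%Z with (Z.of_nat (S N) + n)%Z by lia.
replace (Z.of_nat N - (n - 1))%Z with (Z.of_nat (S N) - n)%Z by lia.
replace (Z.of_nat N + (n - 1))%Z with (Z.of_nat N + n - 1)%Z by lia.
replace (Z.of_nat N - (n + 1))%Z with (Z.of_nat N - n - 1)%Z by lia.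
rewrite (ipoch_pred R (Z.of_nat N + n)), (ipoch_pred R (Z.of_nat N - n)) by trivial.
(* All reciprocals are expressed through those at N+1+n and N+1-n; what remains is a rational
   identity in X = p^n, Y = p^N and p. *)
replace (ipoch R (Z.of_nat N + n)) with (ipoch R (Z.of_nat (S N) + n - 1)) by (f_equal; lia).
replace (ipoch R (Z.of_nat N - n)) with (ipoch R (Z.of_nat (S N) - n - 1)) by (f_equal; lia).
rewrite (ipoch_pred R (Z.of_nat (S N) + n)), (ipoch_pred R (Z.of_nat (S N) - n)) by trivial.
set (a := ipoch R (Z.of_nat (S N) + n)); set (b := ipoch R (Z.of_nat (S N) - n)).
set (X := cexp (CZ n * (2 * R))).
assert (HX : X <> 0) by apply cexp_neq0.
assert (E1 : cexp (CZ (Z.of_nat N + n) * (2 * R)) = Y * X).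
{ unfold X, Y; rewrite <- cexp_plus, CZ_add, CZ_of_nat; f_equal; ring. }
assert (E2 : cexp (CZ (Z.of_nat N - n) * (2 * R)) = Y / X).
{ unfold X, Y; rewrite <- cexp_minus, CZ_sub, CZ_of_nat; f_equal; ring. }
assert (E3 : cexp (CZ (Z.of_nat (S N) + n) * (2 * R)) = Y * X * p).
{ unfold X, Y, p; rewrite <- !cexp_plus, CZ_add, CZ_of_nat, S_INR, RtoC_plus; f_equal; ring. }
assert (E4 : cexp (CZ (Z.of_nat (S N) - n) * (2 * R)) = Y * p / X).
{ unfold X, Y, p; rewrite <- cexp_plus, <- cexp_minus, CZ_sub, CZ_of_nat, S_INR, RtoC_plus.
  f_equal; ring. }
rewrite E1, E2, E3, E4.
replace (Y * cexp z * ((1 - Y * X) * ((1 - Y * X * p) * a) * b * jterm R z (n - 1)))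
  with (Y * ((1 - Y * X) * ((1 - Y * X * p) * a) * b) * (cexp z * jterm R z (n - 1))) by ring.
replace (Y * p / cexp z * (a * ((1 - Y / X) * ((1 - Y * p / X) * b)) * jterm R z (n + 1)))
  with (Y * p * (a * ((1 - Y / X) * ((1 - Y * p / X) * b))) * (jterm R z (n + 1) / cexp z))
  by (field; split; [exact HX | apply cexp_neq0]).
rewrite jterm_pred, jterm_succ; fold X p.
field; exact HX.
Qed.

Lemma finite_jacobi (R x : C) (N : nat) :
  (Re R < 0)%R ->
  zsum (finite_jterm R (x + i_pi) N)
    (qp_upto x (2 * R) N * qp_upto (2 * R - x) (2 * R) N / qp_upto (2 * R) (2 * R) (2 * N)).
Proof.
intros HR; assert (HP := Re_double R HR).
induction N as [| N IH].
(* For N = 0 only the term n = 0 survives; the window contains it from size 1 on. *)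
- apply Cconv_eps; intros eps He; exists 1%nat; intros M HM.
  replace (zpart (finite_jterm R (x + i_pi) 0) M) with (RtoC 1).
  + unfold qp_upto; simpl.
    match goal with |- (Cmod ?t < _)%R => replace t with (RtoC 0) by (field; apply C1_nz) end.
    now rewrite Cmod_0.
  + induction M as [| [| M] IHM]; [lia | |].
    * change (RtoC 1 = 0 + (/ 1 * / 1 * jterm R (x + i_pi) 0
                               + 0 * / qp_upto (2 * R) (2 * R) 1 * jterm R (x + i_pi) (-1))).
      unfold jterm at 1.
      replace (R * (CZ 0 * (CZ 0 - 1)) + CZ 0 * (x + i_pi)) with (RtoC 0) by (unfold CZ; ring).
      rewrite cexp_0; field; first [apply C1_nz | now apply qp_upto_neq0].
    * rewrite zpart_S, <- IHM by lia; unfold finite_jterm, ipoch.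
      replace (Z.of_nat 0 - Z.of_nat (S M) <? 0)%Z with true by (symmetry; apply Z.ltb_lt; lia).
      replace (Z.of_nat 0 + (-1 - Z.of_nat (S M)) <? 0)%Z with true
        by (symmetry; apply Z.ltb_lt; lia).
      ring.
- set (z := x + i_pi) in *.
  set (p := cexp (2 * R)); set (Y := cexp (RtoC (INR N) * (2 * R))).
  assert (Hd := finite_jterm_decays R z N HR).
  assert (Hm := zsum_shift _ _ (-1) Hd IH).
  assert (Hp := zsum_shift _ _ 1 Hd IH).
  set (l := qp_upto x (2 * R) N * qp_upto (2 * R - x) (2 * R) N
            / qp_upto (2 * R) (2 * R) (2 * N)) in *.
  assert (EY : forall k, cexp (2 * R + RtoC (INR k) * (2 * R)) = p * cexp (RtoC (INR k) * (2 * R))).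
  { intros k; now rewrite cexp_plus. }
  assert (EYY : cexp (RtoC (INR (2 * N)) * (2 * R)) = Y * Y).
  { unfold Y; rewrite <- cexp_plus; f_equal; rewrite mult_INR, RtoC_mult; simpl INR.
    replace (RtoC (1 + 1)) with (RtoC 2) by (f_equal; ring); ring. }
  assert (EYY1 : cexp (RtoC (INR (S (2 * N))) * (2 * R)) = Y * Y * p).
  { rewrite S_INR, RtoC_plus, <- EYY; unfold p; rewrite <- cexp_plus; f_equal; ring. }
  assert (Epp : qp_upto (2 * R) (2 * R) (2 * S N)
                = qp_upto (2 * R) (2 * R) (2 * N) * (1 - Y * Y * p) * (1 - Y * Y * p * p)).
  { replace (2 * S N)%nat with (S (S (2 * N))) by lia.
    rewrite !qp_upto_S, !EY, EYY, EYY1; ring. }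
  assert (Hnz := qp_upto_neq0 (2 * R) (2 * R) (2 * S N) HP HP); rewrite Epp in Hnz.
  assert (H0 := qp_upto_neq0 (2 * R) (2 * R) (2 * N) HP HP).
  assert (H1 : 1 - Y * Y * p <> 0) by (intros H; apply Hnz; rewrite H; ring).
  assert (H2 : 1 - Y * Y * p * p <> 0) by (intros H; apply Hnz; rewrite H; ring).
  assert (Hz := cexp_neq0 z).
  apply zsum_ext with (fun n => / ((1 - Y * Y * p) * (1 - Y * Y * p * p)) *
    ((1 + Y * Y * p) * finite_jterm R z N n + Y * cexp z * finite_jterm R z N (n - 1)
     + Y * p / cexp z * finite_jterm R z N (n + 1))).
  + intros n; unfold p, Y; rewrite <- (finite_jterm_step R z N n HR); fold p Y.
    field; split; trivial.
  + replace (qp_upto x (2 * R) (S N) * qp_upto (2 * R - x) (2 * R) (S N)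
               / qp_upto (2 * R) (2 * R) (2 * S N))
      with (/ ((1 - Y * Y * p) * (1 - Y * Y * p * p)) *
             ((1 + Y * Y * p) * l + Y * cexp z * l + Y * p / cexp z * l)).
    * apply zsum_scal, zsum_plus; [apply zsum_plus |]; apply zsum_scal; trivial.
    * rewrite Epp.
      rewrite (qp_upto_S x), (qp_upto_S (2 * R - x)).
      unfold l, z in *; rewrite cexp_add_i_pi in *.
      rewrite (cexp_plus x), (cexp_plus (2 * R - x)), cexp_minus; fold p Y.
      assert (Hx := cexp_neq0 x).
      field; repeat split; trivial.
Qed.

(* The theta function with base p = e^{2R} at the point e^x; the logarithmic
   variables give access to the half periods -1, e^R, -e^R as i_pi, R, R + i_pi. *)
Definition theta (R x : C) : C := qp x (2 * R) * qp (2 * R - x) (2 * R).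

(** Let N tend to infinity in [finite_jacobi]: the products tend to theta / h and, by [tannery], the
    sums tend to s / h^2. *)
Lemma jacobi_triple_product (R x : C) :
  (Re R < 0)%R -> zsum (jterm R (x + i_pi)) (qp (2 * R) (2 * R) * theta R x).
Proof.
intros HR; assert (HP := Re_double R HR).
set (h := qp (2 * R) (2 * R)).
assert (Hh : h <> 0) by now apply qp_neq0.
destruct (zsum_exists _ (jterm_decays R (x + i_pi) HR)) as [s Hs].
replace (h * theta R x) with s; trivial.
assert (H1 : Cconv (fun N => qp_upto x (2 * R) N * qp_upto (2 * R - x) (2 * R) N
                             / qp_upto (2 * R) (2 * R) (2 * N)) (theta R x / h)).
{ apply Cconv_mult.
  - apply Cconv_mult; now apply qp_conv.
  - apply (Cconv_subseq (fun n => / qp_upto (2 * R) (2 * R) n) _ (fun N => 2 * N)%nat); [lia |].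
    apply Cconv_inv; [trivial | intros n; now apply qp_upto_neq0 | now apply qp_conv]. }
assert (H2 : Cconv (fun N => qp_upto x (2 * R) N * qp_upto (2 * R - x) (2 * R) N
                             / qp_upto (2 * R) (2 * R) (2 * N)) (/ h * / h * s)).
{ destruct (finite_jterm_bound R (x + i_pi) HR) as [D HD].
  apply tannery with (finite_jterm R (x + i_pi)) (fun n => / h * / h * jterm R (x + i_pi) n) D.
  - intros K; exists O; intros N _.
    apply zsum_tail; [apply HD | now apply finite_jacobi].
  - intros n; apply Cconv_mult; [| apply Cconv_const].
    apply Cconv_mult; [now apply ipoch_conv |].
    apply Cconv_ext with (fun N => ipoch R (Z.of_nat N + - n)); [reflexivity |].
    now apply ipoch_conv.
  - now apply zsum_scal. }
assert (E := Cconv_unique _ _ _ H1 H2).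
replace s with (h * h * (/ h * / h * s)) by (field; trivial).
rewrite <- E; field; trivial.
Qed.

(** * Theta functions and their quotients *)

(** The factor e^{-x} makes this antisymmetric in x and y; it turns out to be a 2 by 2 minor, whence
    the name. *)
Definition theta_wedge (R x y : C) : C := cexp (- x) * theta R (x + y) * theta R (x - y).

(** The substitution m = i + k, 2i - m = i - k diagonalises the quadratic exponent, so the variables
    i and k separate; the sign is e^{2 pi i} to the power i. For an odd index sum a factor -e^{x-y}
    remains. *)
Lemma jterm_mul_even (R x y : C) (i m : Z) :
  jterm R (x + y + i_pi) m * jterm R (x - y + i_pi) (2 * i - m)
  = jterm (2 * R) (2 * x) i * jterm (2 * R) (2 * y + 2 * R) (m - i).
Proof.
unfold jterm; rewrite <- !cexp_plus.
symmetry; rewrite <- (cexp_add_2ipi _ i); f_equal; rewrite !CZ_sub, CZ_mul; unfold CZ; ring.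
Qed.

Lemma jterm_mul_odd (R x y : C) (i m : Z) :
  jterm R (x + y + i_pi) m * jterm R (x - y + i_pi) (2 * i + 1 - m)
  = (- cexp x * jterm (2 * R) (2 * x + 2 * R) i) * (cexp (- y) * jterm (2 * R) (2 * y) (m - i)).
Proof.
rewrite <- cexp_add_i_pi; unfold jterm; rewrite <- !cexp_plus.
symmetry; rewrite <- (cexp_add_2ipi _ i); f_equal; rewrite !CZ_sub, CZ_add, CZ_mul; unfold CZ; ring.
Qed.

(** The product of two triple-product series is arranged by the sum s of the two indices; the even s
    and the odd s each contribute a product of two single series. *)
Lemma theta_wedge_bilinear (R : C) :
  (Re R < 0)%R -> exists A B : C -> C, forall x y, theta_wedge R x y = A x * B y - B x * A y.
Proof.
intros HR; assert (HP := Re_double R HR).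
set (h := qp (2 * R) (2 * R)); set (H := qp (2 * (2 * R)) (2 * (2 * R))).
assert (Hh : h <> 0) by now apply qp_neq0.
set (A0 := fun x => H * theta (2 * R) (2 * x - i_pi)).
set (B0 := fun x => H * theta (2 * R) (2 * x + 2 * R - i_pi)).
assert (HA : forall x, zsum (jterm (2 * R) (2 * x)) (A0 x)).
{ intros x; replace (2 * x) with (2 * x - i_pi + i_pi) at 1 by ring.
  now apply jacobi_triple_product. }
assert (HB : forall x, zsum (jterm (2 * R) (2 * x + 2 * R)) (B0 x)).
{ intros x; replace (2 * x + 2 * R) with (2 * x + 2 * R - i_pi + i_pi) at 1 by ring.
  now apply jacobi_triple_product. }
(* The prefactor e^{-x} / h^2 is absorbed into A; in the odd part it cancels e^x, leaving e^{-y} for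
   A(y). *)
exists (fun x => cexp (- x) * A0 x / (h * h)), B0; intros x y.
set (a := jterm R (x + y + i_pi)); set (b := jterm R (x - y + i_pi)).
assert (L1 : Cconv (fun N => zpart (fun m => zpart (fun s => a m * b (s - m)%Z) (2 * N)) (2 * N))
               ((h * theta R (x + y)) * (h * theta R (x - y)))).
{ destruct (jterm_decay R (x + y + i_pi) HR) as [D HD].
  apply (zpart_convolution a b _ _ D (fun N => 2 * N)%nat (fun N => 2 * N)%nat);
    try (intros; lia); trivial.
  - now apply jterm_decays.
  - now apply jacobi_triple_product.
  - now apply jacobi_triple_product. }
assert (L2 : Cconv (fun N => zpart (fun m => zpart (fun s => a m * b (s - m)%Z) (2 * N)) (2 * N))
               (A0 x * B0 y + (- cexp x * B0 x) * (cexp (- y) * A0 y))).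
{ apply Cconv_ext with (fun N =>
    zpart (fun i => zpart (fun m => jterm (2 * R) (2 * x) i
                                    * jterm (2 * R) (2 * y + 2 * R) (m - i)) (2 * N)) N
    + zpart (fun i => zpart (fun m =>
        (- cexp x * jterm (2 * R) (2 * x + 2 * R) i)
        * (cexp (- y) * jterm (2 * R) (2 * y) (m - i))) (2 * N)) N).
  (* After the exchange s is the outer index, and its window 2N splits into two windows N for i. *)
  - intros N; symmetry; rewrite zpart_exchange, zpart_parity; f_equal.
    + apply zpart_ext; intros i; apply zpart_ext; intros m; apply jterm_mul_even.
    + apply zpart_ext; intros i; apply zpart_ext; intros m; apply jterm_mul_odd.
  - apply Cconv_plus.
    + destruct (jterm_decay (2 * R) (2 * x) HP) as [D HD].
      apply (zpart_convolution _ _ _ _ D (fun N => N) (fun N => 2 * N)%nat);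
        try (intros; lia); trivial.
      now apply jterm_decays.
    + destruct (jterm_decay (2 * R) (2 * x + 2 * R) HP) as [D HD].
      apply (zpart_convolution (fun i => - cexp x * jterm (2 * R) (2 * x + 2 * R) i)
               (fun k => cexp (- y) * jterm (2 * R) (2 * y) k) _ _ (Cmod (- cexp x) * D)%R
               (fun N => N) (fun N => 2 * N)%nat); try (intros; lia).
      * intros n; rewrite Cmod_mult, (Rmult_assoc (Cmod (- cexp x))).
        apply Rmult_le_compat_l; [apply Cmod_ge_0 | apply HD].
      * destruct (jterm_decays (2 * R) (2 * y) HP) as [D' HD'].
        exists (Cmod (cexp (- y)) * D')%R; intros n.
        rewrite Cmod_mult, (Rmult_assoc (Cmod (cexp (- y)))).
        apply Rmult_le_compat_l; [apply Cmod_ge_0 | apply HD'].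
      * now apply zsum_scal.
      * now apply zsum_scal. }
assert (E := Cconv_unique _ _ _ L1 L2).
unfold theta_wedge.
replace (cexp (- x) * theta R (x + y) * theta R (x - y))
  with (cexp (- x) / (h * h) * ((h * theta R (x + y)) * (h * theta R (x - y))))
  by (field; trivial).
rewrite E, !cexp_opp.
assert (Hx := cexp_neq0 x); assert (Hy := cexp_neq0 y).
field; repeat split; trivial.
Qed.

(** The Plücker relation for 2 by 2 minors, which is Weierstrass's three-term theta identity. *)
Lemma theta_wedge_plucker (R x y z w : C) :
  (Re R < 0)%R ->
  theta_wedge R x z * theta_wedge R y w - theta_wedge R x w * theta_wedge R y z
  = theta_wedge R x y * theta_wedge R z w.
Proof.
intros HR; destruct (theta_wedge_bilinear R HR) as [A [B H]]; rewrite !H; ring.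
Qed.

Lemma theta_ext (R x y : C) :
  (Re R < 0)%R -> cexp x = cexp y -> theta R x = theta R y.
Proof.
intros HR H; apply Re_double in HR; unfold theta; f_equal; apply qp_ext; trivial.
now rewrite !cexp_minus, H.
Qed.

Lemma theta_reflect (R x : C) : theta R (2 * R - x) = theta R x.
Proof.
unfold theta; replace (2 * R - (2 * R - x)) with x by ring; ring.
Qed.

Lemma theta_opp (R x : C) :
  (Re R < 0)%R -> theta R (- x) = - cexp (- x) * theta R x.
Proof.
intros HR; apply Re_double in HR; unfold theta.
replace (2 * R - - x) with (x + 2 * R) by ring.
rewrite (qp_step (- x)), (qp_step x) by trivial.
replace (- x + 2 * R) with (2 * R - x) by ring.
rewrite cexp_opp; assert (Hx := cexp_neq0 x); field; trivial.
Qed.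

Lemma theta_sub_period (R x : C) :
  (Re R < 0)%R -> theta R (x - 2 * R) = - cexp (x - 2 * R) * theta R x.
Proof.
intros HR; replace (x - 2 * R) with (- (2 * R - x)) by ring.
now rewrite theta_opp, theta_reflect by trivial.
Qed.

(** Factor 1 - X^2 = (1 - X)(1 + X) to pass to base e^R, then split each product by parity to return
    to base e^{2R}. *)
Lemma qp_duplication (R x : C) :
  (Re R < 0)%R ->
  qp (2 * x) (2 * R)
  = qp x (2 * R) * qp (x + i_pi) (2 * R) * qp (x + R) (2 * R) * qp (x + R + i_pi) (2 * R).
Proof.
intros HR; assert (HP := Re_double R HR).
assert (E : qp (2 * x) (2 * R) = qp x R * qp (x + i_pi) R).
{ apply Cconv_unique with (qp_upto (2 * x) (2 * R)); [now apply qp_conv |].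
  apply Cconv_ext with (fun N => qp_upto x R N * qp_upto (x + i_pi) R N).
  - intros N; unfold qp_upto; rewrite <- cprod_mult; apply cprod_ext; intros k.
    replace (x + i_pi + RtoC (INR k) * R) with (x + RtoC (INR k) * R + i_pi) by ring.
    replace (2 * x + RtoC (INR k) * (2 * R))
      with ((x + RtoC (INR k) * R) + (x + RtoC (INR k) * R)) by ring.
    rewrite cexp_add_i_pi, (cexp_plus (x + RtoC (INR k) * R)); ring.
  - apply Cconv_mult; now apply qp_conv. }
assert (E2 : forall y, qp y R = qp y (2 * R) * qp (y + R) (2 * R)).
{ intros y; rewrite (qp_split y R 2) by (trivial; lia); simpl.
  replace (RtoC (1 + 1)) with (RtoC 2) by (f_equal; ring).
  replace (y + 0 * R) with y by ring; replace (y + 1 * R) with (y + R) by ring; ring. }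
rewrite E, !E2; replace (x + i_pi + R) with (x + R + i_pi) by ring; ring.
Qed.

Lemma theta_duplication (R x : C) :
  (Re R < 0)%R ->
  theta R (2 * x)
  = theta R x * theta R (x + i_pi) * theta R (x + R) * theta R (x + R + i_pi).
Proof.
intros HR; assert (HP := Re_double R HR); unfold theta.
replace (2 * R - 2 * x) with (2 * (R - x)) by ring.
rewrite !qp_duplication by trivial.
replace (R - x + R) with (2 * R - x) by ring.
replace (2 * R - (x + R)) with (R - x) by ring.
rewrite (qp_ext (2 * R - (x + i_pi)) (2 * R - x + i_pi)),
  (qp_ext (2 * R - (x + R + i_pi)) (R - x + i_pi)); trivial.
- ring.
- replace (2 * R - (x + R + i_pi)) with (R - x - i_pi) by ring.
  now rewrite cexp_sub_i_pi, cexp_add_i_pi.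
- replace (2 * R - (x + i_pi)) with (2 * R - x - i_pi) by ring.
  now rewrite cexp_sub_i_pi, cexp_add_i_pi.
Qed.

Lemma theta_constants (R : C) :
  (Re R < 0)%R -> theta R i_pi * theta R R * theta R (R + i_pi) = 2.
Proof.
intros HR; assert (HP := Re_double R HR).
assert (Hh := qp_neq0 (2 * R) (2 * R) HP HP).
assert (E := qp_duplication R R HR).
replace (R + R) with (2 * R) in E by ring.
(* Euler's identity, obtained by cancelling (p;p) in the duplication formula at x = R. The three
   thetas are squares of these factors, apart from one factor 1 - (-1) = 2. *)
assert (E1 : qp R (2 * R) * qp (R + i_pi) (2 * R) * qp (2 * R + i_pi) (2 * R) = 1).
{ replace (qp R (2 * R) * qp (R + i_pi) (2 * R) * qp (2 * R + i_pi) (2 * R))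
    with (qp R (2 * R) * qp (R + i_pi) (2 * R) * qp (2 * R) (2 * R) * qp (2 * R + i_pi) (2 * R)
          / qp (2 * R) (2 * R)) by (field; trivial).
  rewrite <- E; field; trivial. }
unfold theta.
rewrite (qp_step i_pi), cexp_i_pi by trivial.
replace (i_pi + 2 * R) with (2 * R + i_pi) by ring.
replace (2 * R - R) with R by ring.
rewrite (qp_ext (2 * R - i_pi) (2 * R + i_pi)), (qp_ext (2 * R - (R + i_pi)) (R + i_pi)); trivial.
- set (b := qp R (2 * R)) in *; set (c := qp (R + i_pi) (2 * R)) in *.
  set (a := qp (2 * R + i_pi) (2 * R)) in *.
  transitivity (2 * ((b * c * a) * (b * c * a))); [ring | rewrite E1; ring].
- replace (2 * R - (R + i_pi)) with (R - i_pi) by ring.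
  now rewrite cexp_sub_i_pi, cexp_add_i_pi.
- now rewrite cexp_sub_i_pi, cexp_add_i_pi.
Qed.

(** * Half periods and differences of Weierstrass values *)

Lemma theta_wedge_0 (R x : C) : theta_wedge R x 0 = theta R x * theta R x / cexp x.
Proof.
unfold theta_wedge; rewrite cexp_opp.
replace (x + 0) with x by ring; replace (x - 0) with x by ring.
field; apply cexp_neq0.
Qed.

(** For a half period y the points x + y and x - y differ by a period, so the wedge is a theta
    square up to an exponential factor; the next two lemmas rest on the same fact. *)
Lemma theta_wedge_i_pi (R x : C) :
  (Re R < 0)%R -> theta_wedge R x i_pi = theta R (x + i_pi) * theta R (x + i_pi) / cexp x.
Proof.
intros HR; unfold theta_wedge; rewrite cexp_opp, (theta_ext R (x - i_pi) (x + i_pi)).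
- field; apply cexp_neq0.
- trivial.
- now rewrite cexp_sub_i_pi, cexp_add_i_pi.
Qed.

Lemma theta_wedge_R (R x : C) :
  (Re R < 0)%R -> theta_wedge R x R = - theta R (x + R) * theta R (x + R) / cexp R.
Proof.
intros HR; unfold theta_wedge; rewrite cexp_opp.
replace (x - R) with (x + R - 2 * R) by ring.
rewrite theta_sub_period by trivial.
replace (x + R - 2 * R) with (x - R) by ring; rewrite cexp_minus.
assert (H1 := cexp_neq0 x); assert (H2 := cexp_neq0 R); field; split; trivial.
Qed.

Lemma theta_wedge_R_i_pi (R x : C) :
  (Re R < 0)%R ->
  theta_wedge R x (R + i_pi) = theta R (x + R + i_pi) * theta R (x + R + i_pi) / cexp R.
Proof.
intros HR; unfold theta_wedge; rewrite cexp_opp.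
replace (x + (R + i_pi)) with (x + R + i_pi) by ring.
replace (x - (R + i_pi)) with (x - R - i_pi) by ring.
rewrite (theta_ext R (x - R - i_pi) (x + R + i_pi - 2 * R)), theta_sub_period; trivial.
- replace (x + R + i_pi - 2 * R) with (x - R + i_pi) by ring; rewrite cexp_add_i_pi, cexp_minus.
  assert (H1 := cexp_neq0 x); assert (H2 := cexp_neq0 R); field; split; trivial.
- replace (x + R + i_pi - 2 * R) with (x - R + i_pi) by ring.
  now rewrite cexp_sub_i_pi, cexp_add_i_pi.
Qed.

(* The difference P(x) - P(y) of two values of a Weierstrass-type function P,
   normalised so that no transcendental constant occurs. *)
Definition wp_diff (R x y : C) : C := theta_wedge R x y / (theta_wedge R x 0 * theta_wedge R y 0).

(** The Plücker relation with fourth point 0, divided by the three wedges with 0. *)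
Lemma wp_diff_sub (R x y z : C) :
  (Re R < 0)%R -> theta R x <> 0 -> theta R y <> 0 -> theta R z <> 0 ->
  wp_diff R x z - wp_diff R y z = wp_diff R x y.
Proof.
intros HR Hx Hy Hz; unfold wp_diff.
assert (Hnz : forall t, theta R t <> 0 -> theta_wedge R t 0 <> 0).
{ intros t Ht; rewrite theta_wedge_0; unfold Cdiv; rewrite <- cexp_opp.
  apply Cmult_neq_0; [now apply Cmult_neq_0 | apply cexp_neq0]. }
apply Hnz in Hx, Hy, Hz.
transitivity ((theta_wedge R x z * theta_wedge R y 0 - theta_wedge R x 0 * theta_wedge R y z)
              / (theta_wedge R x 0 * theta_wedge R y 0 * theta_wedge R z 0)).
- field; repeat split; trivial.
- rewrite theta_wedge_plucker by trivial; field; repeat split; trivial.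
Qed.

Lemma theta_constants_neq0 (R : C) :
  (Re R < 0)%R -> theta R i_pi <> 0 /\ theta R R <> 0 /\ theta R (R + i_pi) <> 0.
Proof.
intros HR; assert (H := theta_constants R HR).
assert (H2 : RtoC 2 <> 0) by (intros E; apply RtoC_inj in E; lra).
repeat split; intros H0; apply H2; rewrite <- H, H0; ring.
Qed.

(** The counterpart of the cubic equation for the square of the derivative of P: duplication
    collects the numerators into theta(2x)^2, and the 4 is the square of [theta_constants]. *)
Lemma wp_diff_half_periods (R x : C) :
  (Re R < 0)%R -> theta R x <> 0 ->
  wp_diff R x i_pi * wp_diff R x R * wp_diff R x (R + i_pi)
  = - (cexp x * cexp x * theta R (2 * x) * theta R (2 * x)) / (4 * theta R x ^ 8).
Proof.
intros HR Hx; unfold wp_diff.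
rewrite theta_wedge_i_pi, theta_wedge_R, theta_wedge_R_i_pi, !theta_wedge_0,
  theta_duplication by trivial.
assert (H := theta_constants R HR).
destruct (theta_constants_neq0 R HR) as [Ha [Hb Hc]].
rewrite cexp_add_i_pi, cexp_i_pi.
replace (RtoC 4) with (2 * 2) by (rewrite <- RtoC_mult; f_equal; ring).
rewrite <- H.
assert (H1 := cexp_neq0 x); assert (H2 := cexp_neq0 R); assert (H3 := C1_nz).
field; repeat split; trivial.
Qed.

(** Sums of two distinct half periods are the third one up to periods, so only the product of the
    three theta constants remains. *)
Lemma wp_diff_discriminant (R : C) :
  (Re R < 0)%R ->
  (wp_diff R i_pi R * wp_diff R i_pi (R + i_pi) * wp_diff R R (R + i_pi)) ^ 2 = cexp (2 * R) / 16.
Proof.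
intros HR; unfold wp_diff.
rewrite !theta_wedge_R_i_pi, theta_wedge_R, !theta_wedge_0 by trivial.
assert (E1 : theta R (i_pi + R + i_pi) = theta R R).
{ apply theta_ext; trivial.
  rewrite cexp_add_i_pi, (Cplus_comm i_pi R), cexp_add_i_pi; ring. }
assert (E2 : theta R (R + R + i_pi) = theta R i_pi).
{ rewrite <- theta_reflect; apply theta_ext; trivial.
  replace (2 * R - (R + R + i_pi)) with (0 - i_pi) by ring.
  rewrite cexp_sub_i_pi, cexp_i_pi, cexp_0; ring. }
rewrite E1, E2, (Cplus_comm i_pi R), cexp_add_i_pi, cexp_i_pi.
assert (H := theta_constants R HR).
destruct (theta_constants_neq0 R HR) as [Ha [Hb Hc]].
replace (2 * R) with (R + R) by ring; rewrite cexp_plus.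
replace (RtoC 16) with ((2 * 2) * (2 * 2)) by (rewrite <- !RtoC_mult; f_equal; ring).
rewrite <- H.
assert (H2 := cexp_neq0 R); assert (H3 := C1_nz).
field; repeat split; trivial.
Qed.

(** * Level seven *)

(* The e_i are the roots of the monic cubic taking the given values at 1, 0 and
   -1/(t-1), that is, at P(q), P(q^2), P(q^3) after an affine change of variable. *)
Lemma interpolated_discriminant (t e1 e2 e3 : C) :
  t <> 0 -> t - 1 <> 0 ->
  (1 - e1) * (1 - e2) * (1 - e3) = t ^ 3 / (4 * (t - 1) ^ 2) ->
  (0 - e1) * (0 - e2) * (0 - e3) = / (4 * t) ->
  (- / (t - 1) - e1) * (- / (t - 1) - e2) * (- / (t - 1) - e3) = t / (4 * (t - 1) ^ 4) ->
  16 * ((e1 - e2) * (e1 - e3) * (e2 - e3)) ^ 2 * (t - 1) ^ 4 / t ^ 2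
  = t + 1 - / t - / (t - 1) - 8.
Proof.
intros Ht Ht1 H1 H0 H3.
assert (H4 : RtoC 4 <> 0) by (intros E; apply RtoC_inj in E; lra).
set (s1 := e1 + e2 + e3); set (s2 := e1 * e2 + e1 * e3 + e2 * e3); set (s3 := e1 * e2 * e3).
set (a := t ^ 3 / (4 * (t - 1) ^ 2) - 1 - / (4 * t)).
set (b := - (t - 1) * (t / (4 * (t - 1) ^ 4) + / (t - 1) ^ 3 - / (4 * t))).
assert (E3 : s3 = - / (4 * t)) by (rewrite <- H0; unfold s3; ring).
assert (Ea : s2 - s1 = a).
{ unfold a; rewrite <- H1, <- H0; unfold s1, s2; ring. }
assert (Eb : s1 * / (t - 1) + s2 = b).
{ unfold b; rewrite <- H3, <- H0; unfold s1, s2; field; trivial. }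
assert (E1 : s1 = (b - a) * (t - 1) / t).
{ rewrite <- Ea, <- Eb; field; split; trivial. }
assert (E2 : s2 = a + s1) by (rewrite <- Ea; ring).
(* The discriminant of a monic cubic in terms of the elementary symmetric functions of its roots. *)
replace (((e1 - e2) * (e1 - e3) * (e2 - e3)) ^ 2)
  with (s1 ^ 2 * s2 ^ 2 - 4 * s2 ^ 3 - 4 * s1 ^ 3 * s3 + 18 * s1 * s2 * s3 - 27 * s3 ^ 2)
  by (unfold s1, s2, s3; ring).
rewrite E2, E1, E3; unfold a, b.
field; repeat split; trivial.
Qed.

Lemma wp_diff_anti (R x y : C) :
  (Re R < 0)%R -> theta R x <> 0 -> theta R y <> 0 -> wp_diff R y x = - wp_diff R x y.
Proof.
intros HR Hx Hy.
assert (H1 := wp_diff_sub R x y x HR Hx Hy Hx).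
assert (H2 := wp_diff_sub R x x x HR Hx Hx Hx).
assert (H3 : wp_diff R x x = 0) by (rewrite <- H2; ring).
rewrite <- H1, H3; ring.
Qed.

Lemma wp_diff_half_periods_scaled (R x : C) (d : C) :
  (Re R < 0)%R -> theta R x <> 0 -> d <> 0 ->
  wp_diff R x i_pi / d * (wp_diff R x R / d) * (wp_diff R x (R + i_pi) / d)
  = - (cexp x * cexp x * theta R (2 * x) * theta R (2 * x)) / (4 * theta R x ^ 8 * d ^ 3).
Proof.
intros HR Hx Hd.
assert (H4 : RtoC 4 <> 0) by (intros E; apply RtoC_inj in E; lra).
transitivity (wp_diff R x i_pi * wp_diff R x R * wp_diff R x (R + i_pi) / d ^ 3).
- field; trivial.
- rewrite wp_diff_half_periods by trivial; field; repeat split; trivial.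
Qed.

Lemma level_seven (Q R : C) :
  (Re Q < 0)%R -> 2 * R = 7 * Q ->
  let q := cexp Q in
  let a := theta R Q in let b := theta R (2 * Q) in let c := theta R (3 * Q) in
  let t := b ^ 2 * c / (q * a ^ 3) in
  a <> 0 /\ b <> 0 /\ c <> 0 /\
  b ^ 3 * c = c ^ 3 * a + q * a ^ 3 * b /\
  (a * b * c) ^ 4 / q = t + 1 - / t - / (t - 1) - 8.
Proof.
intros HQ HRQ q a b c t.
assert (HR : (Re R < 0)%R).
{ apply (f_equal Re) in HRQ; destruct R, Q; simpl in *; lra. }
assert (Hth : forall x, (0 < x < 7)%R -> theta R (RtoC x * Q) <> 0).
{ intros x Hx; unfold theta; rewrite HRQ.
  apply Cmult_neq_0; apply qp_neq0; destruct Q as [Q1 Q2]; simpl in *;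
    assert ((0 < x * - Q1)%R) by (apply Rmult_lt_0_compat; lra);
    assert ((0 < (7 - x) * - Q1)%R) by (apply Rmult_lt_0_compat; lra); lra. }
assert (Ha : a <> 0).
{ unfold a; replace Q with (1 * Q) by ring; apply Hth; lra. }
assert (Hb : b <> 0) by (apply Hth; lra).
assert (Hc : c <> 0) by (apply Hth; lra).
assert (Hq : q <> 0) by apply cexp_neq0.
assert (E2 : cexp (2 * Q) = q ^ 2).
{ replace (2 * Q) with (Q + Q) by ring; rewrite cexp_plus; fold q; ring. }
assert (E3 : cexp (3 * Q) = q ^ 3).
{ replace (3 * Q) with (Q + Q + Q) by ring; rewrite !cexp_plus; fold q; ring. }
assert (T4 : theta R (4 * Q) = c).
{ rewrite <- theta_reflect, HRQ; unfold c; f_equal; ring. }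
assert (T5 : theta R (5 * Q) = b).
{ rewrite <- theta_reflect, HRQ; unfold b; f_equal; ring. }
assert (T6 : theta R (6 * Q) = a).
{ rewrite <- theta_reflect, HRQ; unfold a; f_equal; ring. }
assert (Tm1 : theta R (- Q) = - a / q).
{ rewrite theta_opp, cexp_opp by trivial; fold q a; field; trivial. }
assert (Tm2 : theta R (- (2 * Q)) = - b / q ^ 2).
{ rewrite theta_opp, cexp_opp, E2 by trivial; fold b; field; trivial. }
(* Since 7Q is a period, reflection brings sums and differences of Q, 2Q, 3Q back to these points;
   all three differences of P are monomials. *)
assert (W12 : wp_diff R Q (2 * Q) = - q * c / (a * b ^ 2)).
{ unfold wp_diff; rewrite !theta_wedge_0; unfold theta_wedge.
  replace (Q + 2 * Q) with (3 * Q) by ring; replace (Q - 2 * Q) with (- Q) by ring.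
  rewrite cexp_opp, Tm1, E2; fold q a b c; field; repeat split; trivial. }
assert (W13 : wp_diff R Q (3 * Q) = - q * b / (a ^ 2 * c)).
{ unfold wp_diff; rewrite !theta_wedge_0; unfold theta_wedge.
  replace (Q + 3 * Q) with (4 * Q) by ring; replace (Q - 3 * Q) with (- (2 * Q)) by ring.
  rewrite cexp_opp, Tm2, E3, T4; fold q a b c; field; repeat split; trivial. }
assert (W23 : wp_diff R (2 * Q) (3 * Q) = - q ^ 2 * a / (b * c ^ 2)).
{ unfold wp_diff; rewrite !theta_wedge_0; unfold theta_wedge.
  replace (2 * Q + 3 * Q) with (5 * Q) by ring; replace (2 * Q - 3 * Q) with (- Q) by ring.
  rewrite cexp_opp, Tm1, E2, E3, T5; fold q a b c; field; repeat split; trivial. }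
(* The Klein quartic is P(Q) - P(2Q) = (P(Q) - P(3Q)) - (P(2Q) - P(3Q)) with denominators
   cleared. *)
assert (K : b ^ 3 * c = c ^ 3 * a + q * a ^ 3 * b).
{ assert (E := wp_diff_sub R Q (2 * Q) (3 * Q) HR Ha Hb Hc).
  rewrite W12, W13, W23 in E.
  replace (b ^ 3 * c) with (c ^ 3 * a + q * a ^ 3 * b + a ^ 2 * b ^ 2 * c ^ 2 * / q *
    (- q * c / (a * b ^ 2) - (- q * b / (a ^ 2 * c) - - q ^ 2 * a / (b * c ^ 2)))).
  - rewrite E; ring.
  - field; repeat split; trivial. }
repeat split; trivial.
assert (Ht1 : t - 1 = c ^ 3 / (q * a ^ 2 * b)).
{ unfold t; replace (b ^ 2 * c) with (b ^ 3 * c / b) by (field; trivial).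
  rewrite K; field; repeat split; trivial. }
(* d = P(Q) - P(2Q). Subtracting P(2Q) and dividing by d sends P(Q), P(2Q), P(3Q) to 1, 0,
   -1/(t-1). *)
set (d := - q * c / (a * b ^ 2)) in *.
assert (Hdiv : forall x y : C, x <> 0 -> y <> 0 -> x / y <> 0).
{ intros x y Hx Hy E; apply Hx; replace x with (x / y * y) by (field; trivial).
  rewrite E; ring. }
assert (Hd : d <> 0).
{ unfold d; apply Hdiv; apply Cmult_neq_0; auto using Cpow_nz.
  intros E; apply Hq; replace q with (- - q) by ring; rewrite E; ring. }
assert (Htn : t <> 0).
{ unfold t; apply Hdiv; apply Cmult_neq_0; auto using Cpow_nz. }
assert (Ht1n : t - 1 <> 0).
{ rewrite Ht1; apply Hdiv; auto using Cpow_nz.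
  apply Cmult_neq_0; [apply Cmult_neq_0 |]; auto using Cpow_nz. }
destruct (theta_constants_neq0 R HR) as [He1 [He2 He3]].
assert (H4 : RtoC 4 <> 0) by (intros E; apply RtoC_inj in E; lra).
assert (D : forall x e, theta R x <> 0 -> theta R e <> 0 ->
              wp_diff R x (2 * Q) / d - wp_diff R e (2 * Q) / d = wp_diff R x e / d).
{ intros x e Hx He; rewrite <- (wp_diff_sub R x e (2 * Q)) by trivial; field; trivial. }
assert (D1 : forall e, theta R e <> 0 -> 1 - wp_diff R e (2 * Q) / d = wp_diff R Q e / d).
{ intros e He; rewrite <- (D Q e), W12 by trivial; field; trivial. }
assert (D2 : forall e, theta R e <> 0 -> 0 - wp_diff R e (2 * Q) / d = wp_diff R (2 * Q) e / d).
{ intros e He; rewrite (wp_diff_anti R e (2 * Q)) by trivial; field; trivial. }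
assert (D3 : forall e, theta R e <> 0 ->
               - / (t - 1) - wp_diff R e (2 * Q) / d = wp_diff R (3 * Q) e / d).
{ intros e He; rewrite <- (D (3 * Q) e) by trivial; f_equal.
  rewrite (wp_diff_anti R (2 * Q) (3 * Q)), W23, Ht1 by trivial; unfold d.
  field; repeat split; trivial. }
rewrite <- (interpolated_discriminant t (wp_diff R i_pi (2 * Q) / d) (wp_diff R R (2 * Q) / d)
              (wp_diff R (R + i_pi) (2 * Q) / d)); trivial.
- rewrite !D by trivial.
  (* The scaling divides the discriminant by d^6; its value p/16 with p = q^7 then yields (abc)^4 /
     q. *)
  transitivity (16 * (wp_diff R i_pi R * wp_diff R i_pi (R + i_pi)
                      * wp_diff R R (R + i_pi)) ^ 2 / d ^ 6 * (t - 1) ^ 4 / t ^ 2).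
  + rewrite wp_diff_discriminant, HRQ, Ht1 by trivial.
    replace (cexp (7 * Q)) with (q ^ 7).
    * unfold t, d; field; repeat split; trivial.
    * unfold q; rewrite <- cexp_mul_nat; do 2 f_equal; simpl; f_equal; ring.
  + field; split; trivial.
(* The doubles 2Q, 4Q, 6Q reflect to 2Q, 3Q, Q, so the three interpolation values are monomials in
   q, a, b, c. *)
- rewrite !D1, wp_diff_half_periods_scaled by trivial; fold a b q.
  rewrite Ht1; unfold t, d; field; repeat split; trivial.
- rewrite !D2, wp_diff_half_periods_scaled, E2 by trivial; fold b.
  replace (2 * (2 * Q)) with (4 * Q) by ring; rewrite T4.
  unfold t, d; field; repeat split; trivial.
- rewrite !D3, wp_diff_half_periods_scaled, E3 by trivial; fold c.
  replace (2 * (3 * Q)) with (6 * Q) by ring; rewrite T6.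
  rewrite Ht1; unfold t, d; field; repeat split; trivial.
Qed.

(** * Translation to u, v, w and eta *)

Definition log_q (tau : C) : C := RtoC (2 * PI) * (Ci * tau).

Lemma qpow_log_q (alpha : R) (tau : C) : qpow alpha tau = cexp (RtoC alpha * log_q tau).
Proof. unfold qpow, log_q; f_equal; rewrite RtoC_mult; ring. Qed.

Lemma Re_log_q (tau : C) : (0 < Im tau)%R -> (Re (log_q tau) < 0)%R.
Proof.
intros H; destruct tau as [x y]; unfold log_q, Ci; simpl in *.
assert (H1 := Rmult_lt_0_compat _ _ PI_RGT_0 H); lra.
Qed.

Lemma cinfprod_theta (tau R : C) (a b : Rdefinitions.R) :
  (0 < Im tau)%R -> 2 * R = 7 * log_q tau -> (a + b = 7)%R ->
  cinfprod (fun k =>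
    (1 - qpow (7 * INR k + a) tau) * (1 - qpow (7 * INR k + b) tau)
      * (1 - qpow (7 * INR k + 7) tau))
  = theta R (RtoC a * log_q tau) * qp (2 * R) (2 * R).
Proof.
intros Htau HR Hab.
assert (HP : (Re (2 * R) < 0)%R).
{ rewrite HR; apply Re_log_q in Htau; destruct (log_q tau); simpl in *; lra. }
apply cinfprod_eq, Cconv_ext with
  (fun N => qp_upto (RtoC a * log_q tau) (2 * R) N * qp_upto (2 * R - RtoC a * log_q tau) (2 * R) N
            * qp_upto (2 * R) (2 * R) N).
- intros N; unfold qp_upto; rewrite <- !cprod_mult; apply cprod_ext; intros k.
  rewrite !qpow_log_q, HR; replace b with (7 - a)%R by lra.
  f_equal; [f_equal |]; do 2 f_equal;
    rewrite ?RtoC_plus, ?RtoC_minus, ?RtoC_mult; ring.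
- unfold theta; apply Cconv_mult; [apply Cconv_mult |]; now apply qp_conv.
Qed.

Lemma eta_qp (tau : C) :
  (0 < Im tau)%R -> eta tau = cexp (RtoC (1 / 24) * log_q tau) * qp (log_q tau) (log_q tau).
Proof.
intros Htau; unfold eta; rewrite qpow_log_q; f_equal.
apply cinfprod_eq, Cconv_ext with (qp_upto (log_q tau) (log_q tau));
  [| now apply qp_conv, Re_log_q].
intros N; apply cprod_ext; intros k; rewrite qpow_log_q; do 2 f_equal.
rewrite RtoC_plus; ring.
Qed.

(** The residues j and 7 - j pair into the three thetas; the residue 7 leaves (q^7; q^7). *)
Lemma qp_seven (Q R : C) :
  (Re Q < 0)%R -> 2 * R = 7 * Q ->
  qp Q Q = theta R Q * theta R (2 * Q) * theta R (3 * Q) * qp (2 * R) (2 * R).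
Proof.
intros HQ HR; rewrite (qp_split Q Q 7) by (trivial; lia).
unfold theta; rewrite HR.
replace (RtoC (INR 7)) with (RtoC 7) by (f_equal; simpl; ring).
assert (E : forall j m, (INR j + 1)%R = m -> Q + RtoC (INR j) * Q = RtoC m * Q).
{ intros j m <-; rewrite RtoC_plus; ring. }
cbn [cprod_upto].
rewrite (E 0%nat 1%R), (E 1%nat 2%R), (E 2%nat 3%R), (E 3%nat 4%R), (E 4%nat 5%R),
  (E 5%nat 6%R), (E 6%nat 7%R) by (simpl; ring).
replace (7 * Q - Q) with (6 * Q) by ring.
replace (7 * Q - 2 * Q) with (5 * Q) by ring.
replace (7 * Q - 3 * Q) with (4 * Q) by ring.
replace (RtoC 1 * Q) with Q by ring.
ring.
Qed.

(** Turns fractional powers of q into integer powers of one common root, on which [field] can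
    work. *)
Lemma cexp_scale (Q : C) (r s : Rdefinitions.R) (n : nat) :
  (INR n * s = r)%R -> cexp (RtoC r * Q) = cexp (RtoC s * Q) ^ n.
Proof.
intros <-; rewrite <- cexp_mul_nat, RtoC_mult; f_equal; ring.
Qed.

Theorem theorem7 (tau : C) (Htau : (0 < Im tau)%R) :
  let E := cpow (eta tau / eta (RtoC 7 * tau)) 4 in
  cpow (v tau) 4 * cpow (u tau) 2 / cpow (w tau) 6
  + cpow (u tau) 4 * cpow (w tau) 2 / cpow (v tau) 6
  + cpow (w tau) 4 * cpow (v tau) 2 / cpow (u tau) 6
  = cpow E 2 + RtoC 14 * E + RtoC 54
  /\
  cpow (w tau) 6 / (cpow (v tau) 4 * cpow (u tau) 2)
  + cpow (v tau) 6 / (cpow (u tau) 4 * cpow (w tau) 2)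
  + cpow (u tau) 6 / (cpow (w tau) 4 * cpow (v tau) 2)
  = cpow E 2 + RtoC 12 * E + RtoC 41.
Proof.
intros E.
set (Q := log_q tau); set (R := RtoC (7 / 2) * Q).
assert (HQ : (Re Q < 0)%R) by now apply Re_log_q.
assert (HR : 2 * R = 7 * Q).
{ unfold R; rewrite Cmult_assoc, <- RtoC_mult; do 2 f_equal; field. }
destruct (level_seven Q R HQ HR) as [Ha [Hb [Hc [K HE]]]].
set (q := cexp Q) in *; set (a := theta R Q) in *; set (b := theta R (2 * Q)) in *.
set (c := theta R (3 * Q)) in *; set (t := b ^ 2 * c / (q * a ^ 3)) in *.
set (h := qp (2 * R) (2 * R)).
set (z := cexp (RtoC (1 / 56) * Q)).
assert (Hz : z <> 0) by apply cexp_neq0.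
assert (Hh : h <> 0).
{ apply qp_neq0; rewrite HR; destruct Q; simpl in *; lra. }
assert (Hq : q = z ^ 56).
{ unfold q, z; rewrite <- (cexp_scale Q 1) by (simpl; field); f_equal; ring. }
assert (Hu : u tau = z * c * h).
{ unfold u; rewrite (cinfprod_theta tau R 3 4), qpow_log_q by (trivial || lra).
  fold Q c h z; ring. }
assert (Hv : v tau = z ^ 9 * b * h).
{ unfold v; rewrite (cinfprod_theta tau R 2 5), qpow_log_q by (trivial || lra).
  fold Q b h; unfold z; rewrite <- (cexp_scale Q (9 / 56)) by (simpl; field); ring. }
assert (Hw : w tau = z ^ 25 * a * h).
{ unfold w; rewrite (cinfprod_theta tau R 1 6), qpow_log_q by (trivial || lra).
  fold Q; replace (1 * Q) with Q by ring; fold a h.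
  unfold z; rewrite <- (cexp_scale Q (25 / 56)) by (simpl; field); ring. }
assert (Hun : u tau <> 0) by (rewrite Hu; auto using Cmult_neq_0, Cpow_nz).
assert (Hvn : v tau <> 0) by (rewrite Hv; auto using Cmult_neq_0, Cpow_nz).
assert (Hwn : w tau <> 0) by (rewrite Hw; auto using Cmult_neq_0, Cpow_nz).
assert (Hqn : q <> 0) by apply cexp_neq0.
(* The ratio has degree 0, so h cancels; the exponent of z is 18 + 1 - 75 = -56, which gives 1/q. *)
assert (X1 : v tau ^ 2 * u tau / w tau ^ 3 = t).
{ rewrite Hu, Hv, Hw; unfold t; rewrite Hq; field; repeat split; trivial. }
assert (Htn : t <> 0).
{ intros H0; rewrite H0 in X1.
  assert (H1 : v tau ^ 2 * u tau <> 0) by auto using Cmult_neq_0, Cpow_nz.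
  apply H1; replace (v tau ^ 2 * u tau) with (v tau ^ 2 * u tau / w tau ^ 3 * w tau ^ 3)
    by (field; trivial).
  rewrite X1; ring. }
assert (Ht1 : t - 1 = c ^ 3 / (q * a ^ 2 * b)).
{ unfold t; replace (b ^ 2 * c) with (b ^ 3 * c / b) by (field; trivial).
  rewrite K; field; repeat split; trivial. }
assert (X3 : w tau ^ 2 * v tau / u tau ^ 3 = / (t - 1)).
{ rewrite Ht1, Hu, Hv, Hw, Hq; field; repeat split; trivial. }
assert (Ht1n : t - 1 <> 0).
{ rewrite Ht1; intros H0; apply (Cpow_nz c 3 Hc).
  replace (c ^ 3) with (c ^ 3 / (q * a ^ 2 * b) * (q * a ^ 2 * b))
    by (field; repeat split; trivial).
  rewrite H0; ring. }
(* The three ratios multiply to 1. *)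
assert (X2 : u tau ^ 2 * w tau / v tau ^ 3 = (t - 1) / t).
{ transitivity (/ (v tau ^ 2 * u tau / w tau ^ 3) / (w tau ^ 2 * v tau / u tau ^ 3)).
  - field; repeat split; trivial.
  - rewrite X1, X3; field; split; trivial. }
(* The eta quotient is q^{1/24 - 7/24} abc = q^{-1/4} abc, whose fourth power is (abc)^4 / q. *)
assert (HEt : E = t + 1 - / t - / (t - 1) - 8).
{ rewrite <- HE; unfold E.
  assert (Elq : log_q (RtoC 7 * tau) = 2 * R) by (rewrite HR; unfold Q, log_q; ring).
  rewrite (eta_qp tau Htau), (eta_qp (RtoC 7 * tau)), Elq, (qp_seven _ R); trivial.
  - fold Q a b c h; rewrite HR.
    replace (RtoC (1 / 24) * (7 * Q)) with (RtoC (7 / 24) * Q).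
    + rewrite (cexp_scale Q (7 / 24) (1 / 24) 7) by (simpl; field).
      assert (Hq24 : q = cexp (RtoC (1 / 24) * Q) ^ 24).
      { unfold q; rewrite <- (cexp_scale Q 1) by (simpl; field); f_equal; ring. }
      rewrite Hq24.
      assert (Hy := cexp_neq0 (RtoC (1 / 24) * Q)).
      simpl cpow; field; split; trivial.
    + rewrite Cmult_assoc, <- RtoC_mult; do 2 f_equal; field.
  - destruct tau; simpl in *; lra. }
rewrite HEt; cbn [cpow].
split.
(* Each summand is the square of one of the three ratios, and in the second identity the inverse of
   such a square; both sides become rational functions of t. *)
- transitivity ((v tau ^ 2 * u tau / w tau ^ 3) ^ 2 + (u tau ^ 2 * w tau / v tau ^ 3) ^ 2
                + (w tau ^ 2 * v tau / u tau ^ 3) ^ 2).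
  + field; repeat split; trivial.
  + rewrite X1, X2, X3; field; split; trivial.
- transitivity (/ (v tau ^ 2 * u tau / w tau ^ 3) ^ 2 + / (u tau ^ 2 * w tau / v tau ^ 3) ^ 2
                + / (w tau ^ 2 * v tau / u tau ^ 3) ^ 2).
  + field; repeat split; trivial.
  + rewrite X1, X2, X3; field; split; trivial.
Qed.
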